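(* Let $\mathcal{G}$ be a family of ordered graphs with bounded maximum degree, i.e. there is $\Delta\in\mathbb{N}$ such that every graph in $\mathcal{G}$ has maximum degree at most $\Delta$. Then $\mathcal{G}$ has bounded mixed page number (there is a constant $c$ with $\mathrm{mn}(G)\le c$ for all $G\in\mathcal{G}$) if and only if there exists $k\in\mathbb{N}$ such that every graph in $\mathcal{G}$ contains no $t$-thick pattern with $t>k$ (i.e. the size of the largest thick pattern in every graph of $\mathcal{G}$ is at most $k\times k$).
   Context: An ordered graph is a graph $G$ together with a total order $\prec$ on $V(G)$. For two edges $uv$, $xy$ with $u\prec v$, $x\prec y$ and four distinct endpoints, they cross if $u\prec x\prec v\prec y$ or $x\prec u\prec y\prec v$, and they nest if $u\prec x\prec y\prec v$ or $x\prec u\prec v\prec y$. A stack is a set of edges no two of which cross; a queue is a set of edges no two of which nest. An $s$-stack $q$-queue layout of an ordered graph is a partition of its edge set into $s$ stacks and $q$ queues. The mixed page number $\mathrm{mn}(G)$ is the minimum $s+q$ over all $s$-stack $q$-queue layouts of $G$ (with its given order). A $k$-twist is a set of $k$ pairwise crossing edges; a $k$-rainbow is a set of $k$ pairwise nesting edges. A pattern is an ordered graph with at least one edge; an ordered graph $G$ contains a pattern $H$ if $G$ has a subgraph isomorphic to $H$ via an isomorphism preserving the vertex orders. A $t$-thick $k$-twist consists of $k$ pairwise vertex-disjoint $t$-rainbows such that every edge crosses every edge of the other rainbows; a $t$-thick $k$-rainbow consists of $k$ pairwise vertex-disjoint $t$-twists such that every edge nests with every edge of the other twists. A $k$-thick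 pattern is a $k$-thick $k$-twist or a $k$-thick $k$-rainbow (it has $k^2$ edges, size $k\times k$). *)

(* Defs.v *)
From HB Require Import structures.
From mathcomp Require Import all_boot all_order.

Set Implicit Arguments.
Unset Strict Implicit.
Unset Printing Implicit Defensive.

Import Order.TTheory.

(* Finite simple graphs whose vertex set carries a total order. *)
Record ograph := OGraph {
  vdisp : Order.disp_t;
  vertex : finOrderType vdisp;
  adj : rel vertex;
  adj_sym : symmetric adj;
  adj_irr : irreflexive adj
}.

(* An edge uv with u < v is encoded as the pair (u, v), so that unordered     *)
(* edges correspond one-to-one to elements of [edges G].                      *)
Definition edges (G : ograph) : {set vertex G * vertex G} :=
  [set e | (e.1 < e.2)%O && adj e.1 e.2].

Definition degree (G : ograph) (v : vertex G) : nat :=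
  #|[set w : vertex G | adj v w]|.

Definition max_degree (G : ograph) : nat := \max_(v : vertex G) degree v.

Section EdgeSets.
Variables (d : Order.disp_t) (V : finOrderType d).
Implicit Types (e f : V * V) (F : {set V * V}).

Definition cross e f : bool :=
  [&& e.1 < f.1, f.1 < e.2 & e.2 < f.2]%O
  || [&& f.1 < e.1, e.1 < f.2 & f.2 < e.2]%O.

Definition nest e f : bool :=
  [&& e.1 < f.1, f.1 < f.2 & f.2 < e.2]%O
  || [&& f.1 < e.1, e.1 < e.2 & e.2 < f.2]%O.

Definition is_stack F : bool := [forall e in F, forall f in F, ~~ cross e f].
Definition is_queue F : bool := [forall e in F, forall f in F, ~~ nest e f].

Definition is_twist (k : nat) F : bool :=
  (#|F| == k) && [forall e in F, forall f in F, (e != f) ==> cross e f].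
Definition is_rainbow (k : nat) F : bool :=
  (#|F| == k) && [forall e in F, forall f in F, (e != f) ==> nest e f].

Definition endpoints F : {set V} :=
  [set v | [exists e in F, (v == e.1) || (v == e.2)]].

Definition is_thick_twist (t k : nat) F : Prop :=
  exists R : 'I_k -> {set V * V},
    [/\ F = \bigcup_i R i,
        forall i, is_rainbow t (R i),
        forall i j, i != j -> [disjoint endpoints (R i) & endpoints (R j)]
      & forall i j, i != j ->
          forall e f, e \in R i -> f \in R j -> cross e f].

Definition is_thick_rainbow (t k : nat) F : Prop :=
  exists T : 'I_k -> {set V * V},
    [/\ F = \bigcup_i T i,
        forall i, is_twist t (T i),
        forall i j, i != j -> [disjoint endpoints (T i) & endpoints (T j)]
      & forall i j, i != j ->
          forall e f, e \in T i -> f \in T j -> nest e f].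

End EdgeSets.

(* The parts are [P (inl _)] (stacks) and [P (inr _)] (queues); empty parts   *)
(* are allowed, which does not affect the minimum of s + q.                   *)
Definition is_layout (G : ograph) (s q : nat)
    (P : {ffun 'I_s + 'I_q -> {set vertex G * vertex G}}) : bool :=
  [&& \bigcup_i P i == edges G,
      [forall i, forall j, (i != j) ==> [disjoint P i & P j]],
      [forall i : 'I_s, is_stack (P (inl i))]
    & [forall j : 'I_q, is_queue (P (inr j))]].

Definition has_layout (G : ograph) (s q : nat) : bool :=
  [exists P : {ffun 'I_s + 'I_q -> {set vertex G * vertex G}}, is_layout P].

Definition has_mixed_layout (G : ograph) (p : nat) : bool :=
  [exists s : 'I_p.+1, has_layout G s (p - s)].

Lemma has_mixed_layoutP (G : ograph) (p : nat) :
  reflect (exists s q : nat, s + q = p /\ has_layout G s q)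
          (has_mixed_layout G p).
Proof.
apply: (iffP existsP) => [[s hs]|[s [q [<- hs]]]].
  by exists s, (p - s); split=> //; rewrite subnKC // -ltnS.
have ls : s < (s + q).+1 by rewrite ltnS leq_addr.
by exists (Ordinal ls); rewrite /= addKn.
Qed.

Lemma ex_mixed_layout (G : ograph) : exists p, has_mixed_layout G p.
Proof.
pose s := #|edges G|; exists (s + 0); apply/has_mixed_layoutP.
exists s, 0; split=> //.
pose g (x : 'I_s + 'I_0) : {set vertex G * vertex G} :=
  if x is inl i then [set enum_val i] else set0.
apply/existsP; exists [ffun x => g x]; apply/and4P; split.
- apply/eqP/setP=> e; apply/bigcupP/idP => [[[i|[]//] _]|he].
    by rewrite ffunE inE => /eqP->; apply: enum_valP.
  by exists (inl (enum_rank_in he e)); rewrite // ffunE inE enum_rankK_in.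
- apply/forallP=> -[i|[]//]; apply/forallP=> -[j|[]//]; apply/implyP=> ij.
  rewrite !ffunE disjoints1 inE; apply: contraNneq ij => /enum_val_inj ->.
  exact: eqxx.
- apply/forallP=> i; rewrite ffunE /=.
  apply/forall_inP=> e /set1P->; apply/forall_inP=> f /set1P->.
  by rewrite /cross ltxx.
- by apply/forallP=> -[].
Qed.

Definition mixed_page_number (G : ograph) : nat := ex_minn (ex_mixed_layout G).

Definition is_pattern (H : ograph) : bool := edges H != set0.

(* A strictly increasing map is injective, so this is an order-preserving     *)
(* isomorphism of H onto a (not necessarily induced) subgraph of G.           *)
Definition contains (G H : ograph) : Prop :=
  exists f : vertex H -> vertex G,
    (forall x y, (x < y)%O -> (f x < f y)%O) /\
    (forall x y, adj x y -> adj (f x) (f y)).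

(* As an ordered graph, a thick pattern consists of its edges and their       *)
(* endpoints only, hence the condition excluding isolated vertices.           *)
Definition is_thick_pattern (t : nat) (H : ograph) : Prop :=
  [/\ is_pattern H,
      endpoints (edges H) = [set: vertex H]
    & is_thick_twist t t (edges H) \/ is_thick_rainbow t t (edges H)].

Definition bounded_max_degree (GG : ograph -> Prop) : Prop :=
  exists Delta : nat, forall G, GG G -> max_degree G <= Delta.

Definition bounded_mixed_page_number (GG : ograph -> Prop) : Prop :=
  exists c : nat, forall G, GG G -> mixed_page_number G <= c.

(* Main.v *)
From HB Require Import structures.
Require Import Defs.
From mathcomp Require Import all_boot all_order zify.

(* Greedy edge coloring reduces to matchings, i.e. to families of intervals    *)
(* with pairwise distinct endpoints, any two of which cross, nest or are       *)
(* disjoint.  Two facts then suffice.                                          *)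
(*                                                                             *)
(* (1) Without a large thick pattern, a family splits into a part without a    *)
(* large twist and a part without a large rainbow.  If all intervals share a   *)
(* point, only crossing and nesting occur.  Two splittings then differ in      *)
(* boundedly many intervals by Ramsey, so splittability is decided by bounded  *)
(* subfamilies; an unsplittable bounded F0 has the same crossing pattern with  *)
(* all members of some hardly splittable class, so F0 contains a rainbow       *)
(* crossing that class or a twist nested with it, and one iterates in the      *)
(* class.  In general, cut the line into minimal segments that are hard to     *)
(* split: a twist passing over a segment nests with the twists found in it.    *)
(*                                                                             *)
(* (2) Crossing graphs of intervals are chi-bounded (Gyarfas), so the part     *)
(* without large twists needs few stacks.  A breadth-first layering yields, in *)
(* any family of large chromatic number, a subfamily of large chromatic number *)
(* inside a segment, each member of which is crossed by an interval leaving    *)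
(* the segment; iterating builds twists.                                       *)

Set Implicit Arguments.
Unset Strict Implicit.
Unset Printing Implicit Defensive.

(** * Cliques and colorings *)

(** Necessity is a pigeonhole count. In a layout of a [t]-thick twist, either each of its [t]
    rainbows has an edge in a stack, and these stacks are distinct because edges of different
    rainbows cross; or some rainbow uses queues only, and its [t] nesting edges need [t] of them.
    Thick rainbows are symmetric, so [t] is at most the number of pages ([thick_page_bound],
    [thick_pattern_le]).

    For sufficiency, bounded degree gives boundedly many matchings ([bounded_degree_paged]), each of
    which becomes a family of intervals with distinct integer endpoints. [intervals_split] writes it
    as a union of A and B with bounded twists in A and bounded rainbows in B; it combines
    [dichotomous_split], for families sharing a point, with [segmentation] of the line. A is
    distributed to stacks by [twist_free_colorable], which rests on the twist growth of
    [colorable_or_twist_enters]. B goes to queues because nesting is comparability in a partial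
    order, so chain heights color it ([inest_colorable]). *)

Section Coloring.
Variable T : finType.
Implicit Types (R : rel T) (A B C F : {set T}).

Definition clique R C := [forall e in C, forall f in C, (e != f) ==> R e f].

Definition clique_le R k F :=
  [forall C : {set T}, (C \subset F) && clique R C ==> (#|C| <= k)].

(** The codomain ['I_k.+1] is never empty, so that [k = 0] makes sense: then [c e < k] leaves only
    the empty [F]. *)
Definition colorable R k F :=
  [exists c : {ffun T -> 'I_k.+1},
     [forall e in F, c e < k] &&
     [forall e in F, forall f in F, R e f ==> (c e != c f)]].

Lemma cliqueP R C :
  reflect {in C &, forall e f, e != f -> R e f} (clique R C).
Proof.
apply: (iffP forall_inP) => [h e f eC fC | h e eC].
  by move/forall_inP: (h _ eC) => /(_ _ fC)/implyP.
by apply/forall_inP => f fC; apply/implyP/h.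
Qed.

Lemma cliqueS R A B : A \subset B -> clique R B -> clique R A.
Proof.
move=> /subsetP sAB /cliqueP hB; apply/cliqueP => e f eA fA.
by apply: hB; apply: sAB.
Qed.

Lemma clique_setU1 R C e :
  symmetric R -> clique R C -> {in C, forall f, R e f} -> clique R (e |: C).
Proof.
move=> symR /cliqueP hC heC; apply/cliqueP => f g.
rewrite !inE => /predU1P[->|fC] /predU1P[->|gC]; rewrite ?eqxx //.
- by move=> _; apply: heC.
- by move=> _; rewrite symR; apply: heC.
- exact: hC.
Qed.

Lemma clique_leP R k F :
  reflect (forall C, C \subset F -> clique R C -> #|C| <= k) (clique_le R k F).
Proof.
apply: (iffP forallP) => h C; last by apply/implyP => /andP[]; apply: h.
by move=> sC hC; move/implyP: (h C); apply; rewrite sC.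
Qed.

Lemma clique_leS R j k A B :
  A \subset B -> j <= k -> clique_le R j B -> clique_le R k A.
Proof.
move=> sAB jk /clique_leP h; apply/clique_leP => C sC hC.
by apply: leq_trans jk; apply: h => //; apply: subset_trans sAB.
Qed.

Lemma clique_leU R a b A B :
  clique_le R a A -> clique_le R b B -> clique_le R (a + b) (A :|: B).
Proof.
move=> /clique_leP hA /clique_leP hB; apply/clique_leP => C sC hC.
have -> : C = (C :&: A) :|: (C :&: B) by rewrite -setIUr; apply/esym/setIidPl.
rewrite (leq_trans (leq_card_setU _ _)) // leq_add //.
  by apply: hA; rewrite ?subsetIr //; apply: cliqueS hC; rewrite subsetIl.
by apply: hB; rewrite ?subsetIr //; apply: cliqueS hC; rewrite subsetIl.
Qed.

Lemma clique_le_card R F : clique_le R #|F| F.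
Proof. by apply/clique_leP => C /subset_leq_card. Qed.

Lemma clique_le_gtP R k F :
  ~~ clique_le R k F -> exists C, [/\ C \subset F, clique R C & k < #|C|].
Proof.
case/forallPn => C; rewrite negb_imply -ltnNge => /andP[/andP[sC hC] lt].
by exists C.
Qed.

Lemma colorableP R k F :
  reflect (exists c : T -> nat, {in F, forall e, c e < k} /\
                {in F &, forall e f, R e f -> c e <> c f})
          (colorable R k F).
Proof.
apply: (iffP existsP) => [[c /andP[/forall_inP h1 /forall_inP h2]] | [c [h1 h2]]].
  exists (fun e => nat_of_ord (c e)); split=> // e f eF fF Ref.
  have /forall_inP/(_ _ fF)/implyP/(_ Ref) := h2 _ eF.
  by move=> /eqP ne eq; apply: ne; apply: val_inj.
exists [ffun e => inord (c e)]; apply/andP; split; apply/forall_inP => e eF.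
  by rewrite ffunE inordK ?h1 // ltnW // ltnS h1.
apply/forall_inP => f fF; apply/implyP => Ref; rewrite !ffunE.
have k1 : c e < k.+1 by rewrite ltnS ltnW ?h1.
have k2 : c f < k.+1 by rewrite ltnS ltnW ?h1.
by apply/eqP => /(congr1 val); rewrite /= !inordK //; apply: h2.
Qed.

Lemma colorableS R j k A B :
  A \subset B -> j <= k -> colorable R j B -> colorable R k A.
Proof.
move=> /subsetP sAB jk /colorableP[c [h1 h2]]; apply/colorableP; exists c.
split=> [e /sAB eB | e f /sAB eB /sAB fB]; last exact: h2.
by apply: leq_trans jk; apply: h1.
Qed.

Lemma colorableU R a b A B :
  colorable R a A -> colorable R b B -> colorable R (a + b) (A :|: B).
Proof.
move=> /colorableP[c [c1 c2]] /colorableP[d [d1 d2]]; apply/colorableP.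
exists (fun e => if e \in A then c e else a + d e); split=> [e|e f].
  by rewrite inE; case: ifP => [eA _ | _ /= eB]; [have := c1 _ eA | have := d1 _ eB]; lia.
rewrite !inE; case: ifP => [eA _ | _ /= eB]; case: ifP => [fA _ | _ /= fB] Ref.
- exact: c2.
- have := c1 _ eA; lia.
- have := c1 _ fA; lia.
- have := d2 _ _ eB fB Ref; lia.
Qed.

Lemma colorable_set1 R k e : irreflexive R -> 0 < k -> colorable R k [set e].
Proof.
move=> irrR k0; apply/colorableP; exists (fun=> 0); split=> // f g.
by move=> /set1P-> /set1P->; rewrite irrR.
Qed.

Lemma colorable0 R k : colorable R k set0.
Proof. by apply/colorableP; exists (fun=> 0); split=> [e|e f]; rewrite inE. Qed.

Lemma colorable_glue R k F (kap : T -> nat) :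
  {in F &, forall e f, R e f -> kap e = kap f} ->
  (forall i, colorable R k [set e in F | kap e == i]) -> colorable R k F.
Proof.
move=> hk hi; apply/colorableP.
pose Q i (c : {ffun T -> 'I_k.+1}) :=
  [forall e in [set e in F | kap e == i], c e < k] &&
     [forall e in [set e in F | kap e == i],
     forall f in [set e in F | kap e == i], R e f ==> (c e != c f)].
pose c i := xchoose (existsP (hi i)).
have cP i : Q i (c i) by apply: (xchooseP (existsP (hi i))).
have c1 i e : e \in F -> kap e = i -> c i e < k.
  move=> eF /eqP ki; have /andP[/forall_inP h _] := cP i.
  by apply: h; rewrite inE eF.
exists (fun e => nat_of_ord (c (kap e) e)); split=> [e eF|e f eF fF Ref]; first exact: c1.
rewrite -(hk _ _ eF fF Ref).
have /andP[_ /forall_inP h] := cP (kap e).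
have eS : e \in [set g in F | kap g == kap e] by rewrite inE eF eqxx.
have fS : f \in [set g in F | kap g == kap e].
  by rewrite inE fF (hk _ _ eF fF Ref) eqxx.
have /forall_inP/(_ _ fS)/implyP/(_ Ref) := h _ eS.
by move=> /eqP ne eq; apply: ne; apply: val_inj.
Qed.

(* The color of e is the size of a largest chain below e. *)
Lemma chain_colorable (S R : rel T) k F :
  transitive S -> irreflexive S ->
  (forall e f, R e f -> S e f || S f e) ->
  clique_le (fun e f => S e f || S f e) k F -> colorable R k F.
Proof.
move=> trS irS RS; set R' := fun e f => _; move=> /clique_leP hk.
pose below e C := [&& C \subset F, clique R' C & [forall x in C, S x e]].
pose h e := \max_(C : {set T} | below e C) #|C|.
have up e C : e \in F -> below e C -> (C \subset F /\ clique R' C) /\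
    [/\ e |: C \subset F, clique R' (e |: C) & #|e |: C| = #|C|.+1].
  move=> eF /and3P[sC hC /forall_inP bC]; split=> //; split.
  - by rewrite subUset sub1set eF.
  - apply: clique_setU1 => // [x y|f fC]; first exact: orbC.
    by rewrite /R' bC ?orbT.
  - rewrite cardsU1; case: (boolP (e \in C)) => // /bC; by rewrite irS.
have hS e f : e \in F -> S e f -> h e < h f.
  move=> eF Sef; have b0 : below e set0.
    rewrite /below sub0set /=; apply/andP; split.
      by apply/cliqueP => x y; rewrite inE.
    by apply/forall_inP => x; rewrite inE.
  have below_gt0 : 0 < #|below e| by apply/card_gt0P; exists set0.
  have [C bC hC] := eq_bigmax_cond (fun C : {set T} => #|C|) below_gt0.
  have bC' : below e C by [].
  rewrite /h hC; have [_ [u1 u2 <-]] := up _ _ eF bC'.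
  apply: leq_bigmax_cond; rewrite /below u1 u2; apply/forall_inP => x.
  case/setU1P => [->//|xC]; apply: trS Sef.
  by case/and3P: bC' => _ _ /forall_inP; apply.
apply/colorableP; exists h; split=> [e eF | e f eF fF /RS /orP[] /hS].
- suff : h e <= k.-1 /\ 0 < k by lia.
  have k0 : 0 < k.
    rewrite -(cards1 e); apply: hk; first by rewrite sub1set.
    by apply/cliqueP => x y /set1P-> /set1P->; rewrite eqxx.
  split=> //; apply/bigmax_leqP => C bC; have [_ [u1 u2 u3]] := up _ _ eF bC.
  by have := hk _ u1 u2; rewrite u3; lia.
- move=> /(_ eF); lia.
- move=> /(_ fF); lia.
Qed.

End Coloring.

(** * Splitting a relation without large thick patterns *)

Section Split.
Variables (T : finType) (X N : rel T).
Hypotheses (symX : symmetric X) (symN : symmetric N).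
Implicit Types (A B C F W Z : {set T}).

Definition splittable k F :=
  [exists A : {set T},
     [&& A \subset F, clique_le X k A & clique_le N k (F :\: A)]].

Lemma splitI a b k A B F :
  F \subset A :|: B -> a <= k -> b <= k ->
  clique_le X a A -> clique_le N b B -> splittable k F.
Proof.
move=> s ak bk hA hB; apply/existsP; exists (A :&: F); apply/and3P; split.
- by rewrite subsetIr.
- by apply: clique_leS ak hA; rewrite subsetIl.
- apply: clique_leS bk hB; apply/subsetP => e; rewrite !inE => /andP[n eF].
  by move/subsetP/(_ e eF): s; rewrite inE; move: n; rewrite eF andbT; case: (e \in A).
Qed.

Lemma splitE k F : splittable k F -> exists A B,
  [/\ A \subset F, B \subset F, A :|: B = F, clique_le X k A & clique_le N k B].
Proof.
case/existsP => A /and3P[sA hA hB]; exists A, (F :\: A); split=> //.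
  by rewrite subsetDl.
by apply/setP => e; rewrite !inE; move/subsetP/(_ e): sA; case: (e \in A) => //= ->.
Qed.

Lemma splitS j k A B : A \subset B -> j <= k -> splittable j B -> splittable k A.
Proof.
move=> sAB jk /splitE[A' [B' [_ _ E hA hB]]].
by apply: (splitI _ jk jk hA hB); rewrite E.
Qed.

Lemma splitU a b A B : splittable a A -> splittable b B -> splittable (a + b) (A :|: B).
Proof.
move=> /splitE[A1 [B1 [_ _ EA hA1 hB1]]] /splitE[A2 [B2 [_ _ EB hA2 hB2]]].
apply: (splitI _ _ _ (clique_leU hA1 hA2) (clique_leU hB1 hB2)) => //.
by rewrite -EA -EB setUACA subxx.
Qed.

Lemma split_card F : splittable #|F| F.
Proof.
by apply: (splitI (subsetUl F F)) (leqnn _) (leqnn _) _ _; apply: clique_le_card.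
Qed.

Lemma split_bigcup k (s : seq {set T}) F :
  F \subset \bigcup_(Z <- s) Z -> {in s, forall Z, splittable k Z} ->
  splittable (size s * k) F.
Proof.
move=> sF hs; apply: splitS sF (leqnn _) _.
elim: s hs => [|Z s IH] hs; rewrite ?big_nil ?big_cons /=.
  by apply: splitS (split_card set0); rewrite // cards0.
rewrite mulSn; apply: splitU; first by apply: hs; rewrite mem_head.
by apply: IH => Y Ys; apply: hs; rewrite inE Ys orbT.
Qed.

Lemma split_clique_leX k F : clique_le X k F -> splittable k F.
Proof.
move=> h; apply: (splitI (subsetUl F set0)) (leqnn _) (leq0n _) h _.
by apply: clique_leS (clique_le_card N set0); rewrite ?cards0.
Qed.

Lemma split_glue k F (kap : T -> nat) :
  {in F &, forall e f, X e f || N e f -> kap e = kap f} ->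
  (forall i, splittable k [set e in F | kap e == i]) -> splittable k F.
Proof.
move=> hk hi.
pose Q i A := [&& A \subset [set e in F | kap e == i], clique_le X k A
                & clique_le N k ([set e in F | kap e == i] :\: A)].
pose c i := xchoose (existsP (hi i)).
have cP i : Q i (c i) by apply: (xchooseP (existsP (hi i))).
have glue (R : rel T) (D : nat -> {set T}) (G : {set T}) :
    (forall e f, R e f -> X e f || N e f) -> G \subset F ->
    (forall i, [set e in G | kap e == i] \subset D i) ->
    (forall i, clique_le R k (D i)) -> clique_le R k G.
  move=> hR /subsetP sG sD hD; apply/clique_leP => C /subsetP sC hC.
  have [->|[e eC]] := set_0Vmem C; first by rewrite cards0.
  move/clique_leP: (hD (kap e)); apply => //; apply: subset_trans (sD _).
  apply/subsetP => f fC; rewrite inE sC //=.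
  have [->//|ne] := eqVneq f e.
  by apply/eqP/hk; rewrite ?hR ?sG ?sC //; move/cliqueP: hC; apply.
pose A := [set e in F | e \in c (kap e)].
apply/existsP; exists A; apply/and3P; split.
- by apply/subsetP => e; rewrite inE => /andP[].
- apply: (glue _ c) => [e f ->//| |i|i]; last by case/and3P: (cP i).
    by apply/subsetP => e; rewrite inE => /andP[].
  by apply/subsetP => e; rewrite !inE => /andP[/andP[_ h] /eqP<-].
- apply: (glue _ (fun i => [set e in F | kap e == i] :\: c i)) => [e f ->||i|i].
  + by rewrite orbT.
  + by rewrite subsetDl.
  + apply/subsetP => e; rewrite !inE => /andP[/andP[h eF] /eqP<-].
    by rewrite eF eqxx !andbT; move: h; rewrite eF.
  + by case/and3P: (cP i).
Qed.

(** [D] is indexed by [nat] and read only below [p], so that [thick_extend] adds a block by shifting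
    indices. Blocks have at least [t] elements; [thick_matching] trims them to exact size. *)
Definition thick (R1 R2 : rel T) t p F :=
  exists D : nat -> {set T},
    [/\ forall i, i < p -> D i \subset F,
        forall i, i < p -> t <= #|D i| /\ clique R1 (D i)
      & forall i j, i < p -> j < p -> i != j ->
        {in D i & D j, forall e f, R2 e f}].

Lemma thick0 R1 R2 t F : thick R1 R2 t 0 F.
Proof. by exists (fun=> set0). Qed.

Lemma thickS R1 R2 t p A B : A \subset B -> thick R1 R2 t p A -> thick R1 R2 t p B.
Proof.
move=> sAB [D [h1 h2 h3]]; exists D; split=> // i ip.
by apply: subset_trans sAB; apply: h1.
Qed.

Lemma thick_extend (R1 R2 : rel T) t p C W F :
  symmetric R2 -> C \subset F -> W \subset F -> t <= #|C| -> clique R1 C ->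
  {in C & W, forall e f, R2 e f} ->
  thick R1 R2 t p W -> thick R1 R2 t p.+1 F.
Proof.
move=> sym2 sC sW tC hC hCW [D [h1 h2 h3]].
exists (fun i => if i is j.+1 then D j else C); split=> [[|i]|[|i]|[|i] [|j]] //.
- by move=> ip; apply: subset_trans sW; apply: h1.
- exact: h2.
- move=> _ jp _ e f eC fD; apply: hCW => //; exact: (subsetP (h1 _ jp)).
- move=> ip _ _ e f eD fC; rewrite sym2; apply: hCW => //.
  exact: (subsetP (h1 _ ip)).
- by move=> ip jp ij; apply: h3.
Qed.

(** [F :\: Z] and [Z] are tried as the two parts of a splitting; one of them must fail. *)
Lemma not_split k F Z : Z \subset F -> ~~ splittable k F ->
  (exists C, [/\ C \subset F :\: Z, clique X C & k < #|C|]) \/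
  (exists C, [/\ C \subset Z, clique N C & k < #|C|]).
Proof.
move=> sZ ns; case hX: (clique_le X k (F :\: Z)); last first.
  by left; apply/clique_le_gtP; rewrite hX.
right; apply/clique_le_gtP; apply: contra ns => hN.
apply: (splitI _ _ _ hX hN) => //; apply/subsetP => e eF.
by rewrite !inE eF andbT; case: (e \in Z).
Qed.

(** * Ramsey bounds and local testing of splittability *)

Definition dichotomous F := {in F &, forall e f, e != f -> X e f || N e f}.

Lemma dichotomousS A B : A \subset B -> dichotomous B -> dichotomous A.
Proof. by move=> /subsetP s h e f eA fA; apply: h; apply: s. Qed.

Lemma clique_le_nbhd (R : rel T) k F e : symmetric R -> e \in F ->
  clique_le R k F -> clique_le R k.-1 [set f in F | (f != e) && R e f].
Proof.
move=> symR eF /clique_leP h; apply/clique_leP => C /subsetP sC hC.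
suff : #|e |: C| <= k.
  rewrite cardsU1; case: (boolP (e \in C)) => [/sC|]; last by lia.
  by rewrite inE eqxx andbF.
apply: h.
  rewrite subUset sub1set eF; apply/subsetP => f /sC; by rewrite inE => /andP[].
apply: clique_setU1 => // f /sC; by rewrite inE => /and3P[].
Qed.

Lemma clique_le_gt0 (R : rel T) k F e : clique_le R k F -> e \in F -> 0 < k.
Proof.
move=> /clique_leP h eF; rewrite -(cards1 e); apply: h; rewrite ?sub1set //.
by apply/cliqueP => x y /set1P-> /set1P->; rewrite eqxx.
Qed.

(** Every member of [F] other than [e] is an [X]-neighbor or an [N]-neighbor of [e]; passing to
    these neighborhoods lowers [a] or [b] by one. *)
Lemma ramsey a b F : dichotomous F ->
  clique_le X a F -> clique_le N b F -> #|F| < 2 ^ (a + b).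
Proof.
move E: (a + b) => n; elim: n a b E F => [|n IH] a b E F dF ha hb;
  have [->|[e eF]] := set_0Vmem F; rewrite ?cards0 ?expn_gt0 //;
  have a0 : 0 < a by [exact: clique_le_gt0 ha eF];
  have b0 : 0 < b by [exact: clique_le_gt0 hb eF]; first lia.
set FX := [set f in F | (f != e) && X e f].
set FN := [set f in F | (f != e) && N e f].
have sX : FX \subset F by apply/subsetP => f; rewrite inE => /andP[].
have sN : FN \subset F by apply/subsetP => f; rewrite inE => /andP[].
have h1 : #|FX| < 2 ^ n.
  apply: (IH a.-1 b); [lia|exact: dichotomousS dF|exact: clique_le_nbhd|].
  exact: clique_leS hb.
have h2 : #|FN| < 2 ^ n.
  apply: (IH a b.-1); [lia|exact: dichotomousS dF| |exact: clique_le_nbhd].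
  exact: clique_leS ha.
have : #|F| <= 1 + (#|FX| + #|FN|).
  rewrite -(cards1 e); apply: leq_trans (leq_trans (leq_card_setU _ _) _).
    2: by apply: leq_add (leqnn _) (leq_card_setU FX FN).
  apply: subset_leq_card; apply/subsetP => f fF; rewrite !inE fF /=.
  have [//|ne] := eqVneq f e; apply: dF => //; by rewrite eq_sym.
rewrite expnS; lia.
Qed.

Lemma exists_subset_card n A : n <= #|A| -> exists2 B : {set T}, B \subset A & #|B| = n.
Proof.
move=> nA; exists [set e | e \in take n (enum A)].
  by apply/subsetP => e; rewrite inE => /mem_take; rewrite mem_enum.
have /card_uniqP u := take_uniq n (enum_uniq A).
by rewrite cardsE u size_take -cardE; case: ltngtP nA.
Qed.

(* Greedily pack disjoint cliques of size k+1: either few of them cover a      *)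
(* hitting set of all such cliques, or many of them force a large hitting set. *)
Lemma clique_packing (R : rel T) k n A :
  (exists Y : {set T}, [/\ Y \subset A, #|Y| <= n * k.+1 & clique_le R k (A :\: Y)]) \/
  (exists U : {set T}, [/\ U \subset A, #|U| <= n * k.+1 &
     forall Y : {set T}, clique_le R k (U :\: Y) -> n <= #|Y :&: U|]).
Proof.
elim: n => [|n [[Y [sY cY hY]]|[U [sU cU hU]]]].
- by right; exists set0; rewrite sub0set cards0.
- by left; exists Y; split=> //; rewrite mulSn; lia.
case hAU: (clique_le R k (A :\: U)).
  by left; exists U; split=> //; rewrite mulSn; lia.
have /clique_le_gtP[C0 [sC0 hC0 kC0]] := negbT hAU.
have [C sC cC] := exists_subset_card kC0.
have sCA : C \subset A :\: U by apply: subset_trans sC sC0.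
have hC := cliqueS sC hC0.
right; exists (U :|: C); split.
- by rewrite subUset sU; apply: subset_trans sCA _; rewrite subsetDl.
- by rewrite (leq_trans (leq_card_setU _ _)) // cC mulSn; lia.
move=> Y hY.
have h1 : n <= #|Y :&: U|.
  by apply: hU; apply: clique_leS hY => //; rewrite setSD ?subsetUl.
have h2 : 0 < #|Y :&: C|.
  rewrite lt0n; apply/eqP => /cards0_eq Y0.
  have /clique_leP/(_ C) := hY; rewrite hC cC ltnn => h.
  suff /h/(_ isT) : C \subset (U :|: C) :\: Y by [].
  apply/subsetP => e eC; rewrite !inE eC orbT andbT; apply/negP => eY.
  by have := in_set0 e; rewrite -Y0 inE eY eC.
have d : [disjoint Y :&: U & Y :&: C].
  rewrite disjoints_subset; apply/subsetP => e; rewrite !inE => /andP[_ eU].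
  by rewrite negb_and; apply/orP; right; apply: contraL eU => /(subsetP sCA);
     rewrite inE => /andP[].
rewrite setIUr cardsU (disjoint_setI0 d) cards0; lia.
Qed.

(** In the second outcome of [clique_packing], the part [B'] of [U] would hit all oversized cliques
    of [U] and so have at least [n] elements, while fewer are allowed. *)
Lemma small_hitting_set (R1 R2 : rel T) k n A :
  (forall U : {set T}, U \subset A -> #|U| <= n * k.+1 -> exists A' B' : {set T},
     [/\ U \subset A' :|: B', B' \subset U, clique_le R1 k A' & clique_le R2 k B']) ->
  (forall B' : {set T}, B' \subset A -> clique_le R2 k B' -> #|B'| < n) ->
  exists Y : {set T},
    [/\ Y \subset A, #|Y| <= n * k.+1 & clique_le R1 k (A :\: Y)].
Proof.
move=> loc small; have [//|[U [sU cU hU]]] := clique_packing R1 k n A.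
have [A' [B' [sUA sB hA hB]]] := loc _ sU cU.
have := small _ (subset_trans sB sU) hB; rewrite ltnNge -{1}(setIidPl sB) hU //.
apply: clique_leS hA => //; apply/subsetP => e; rewrite inE => /andP[nB].
by move/(subsetP sUA); rewrite inE (negbTE nB) orbF.
Qed.

(** Room for two hitting sets of size at most [n * k.+1], where [n = 2 ^ (3 * k).+1] is the Ramsey
    bound for clique bounds [2k + 1] and [k]. *)
Definition local_size k := 2 * (2 ^ (3 * k).+1 * k.+1).

(* By Ramsey a splitting of a subset of F differs from the given one of F in   *)
(* boundedly many elements, so few elements hit all oversized cliques of the   *)
(* two parts; these elements are then redistributed by a splitting of their own. *)
Lemma split_local_step k F : dichotomous F ->
  (forall Z : {set T}, Z \subset F -> #|Z| <= local_size k -> splittable k Z) ->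
  splittable (2 * k).+1 F -> splittable (2 * k) F.
Proof.
move=> dF loc /splitE[A [B [sA sB EF hA hB]]].
have leb (U : {set T}) : #|U| <= 2 ^ (3 * k).+1 * k.+1 -> #|U| <= local_size k.
  by rewrite /local_size; lia.
have [YA [sYA cYA hYA]] : exists Y : {set T}, [/\ Y \subset A,
    #|Y| <= 2 ^ (3 * k).+1 * k.+1 & clique_le X k (A :\: Y)].
  apply: (small_hitting_set (R2 := N)) => [U sU cU|Z sZ hZ].
    have /splitE[A' [B' [? ? <- ? ?]]] := loc U (subset_trans sU sA) (leb _ cU).
    by exists A', B'; rewrite subsetUr.
  have -> : (3 * k).+1 = (2 * k).+1 + k by lia.
  apply: ramsey hZ; first by apply: dichotomousS dF; apply: subset_trans sA.
  exact: clique_leS hA.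
have [YB [sYB cYB hYB]] : exists Y : {set T}, [/\ Y \subset B,
    #|Y| <= 2 ^ (3 * k).+1 * k.+1 & clique_le N k (B :\: Y)].
  apply: (small_hitting_set (R2 := X)) => [U sU cU|Z sZ hZ].
    have /splitE[A' [B' [? ? <- ? ?]]] := loc U (subset_trans sU sB) (leb _ cU).
    by exists B', A'; rewrite {1}setUC subsetUl.
  have -> : (3 * k).+1 = k + (2 * k).+1 by lia.
  apply: ramsey hZ _; first by apply: dichotomousS dF; apply: subset_trans sB.
  exact: clique_leS hB.
have /splitE[A' [B' [_ _ EY hA' hB']]] : splittable k (YA :|: YB).
  apply: loc; first by rewrite subUset (subset_trans sYA sA) (subset_trans sYB sB).
  by rewrite (leq_trans (leq_card_setU _ _)) // /local_size; lia.
apply: (splitI _ _ _ (clique_leU hYA hA') (clique_leU hYB hB')); try lia.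
apply/subsetP => e; rewrite -EF => eF; move/setP/(_ e): EY; move: eF.
rewrite !inE; do ![case: (e \in _) => //=].
Qed.

(** Elements are inserted one at a time: each raises the bound from [2k] to [2k + 1], and
    [split_local_step] brings it back. *)
Lemma split_local k F : dichotomous F ->
  (forall Z : {set T}, Z \subset F -> #|Z| <= local_size k -> splittable k Z) ->
  splittable (2 * k) F.
Proof.
move cF: #|F| => n; elim: n F cF => [|n IH] F cF dF loc.
  by apply: splitS (split_card F); rewrite // cF.
have [F0|[e eF]] := set_0Vmem F; first by rewrite F0 cards0 in cF.
apply: split_local_step => //.
have -> : F = [set e] :|: (F :\ e) by rewrite setD1K.
rewrite -add1n; apply: splitU; first by rewrite -{1}(cards1 e) split_card.
have cFe : #|F :\ e| = n by have := cardsD1 e F; rewrite eF; lia.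
apply: IH cFe _ _; first by apply: dichotomousS dF; rewrite subD1set.
by move=> Z sZ; apply: loc; apply: subset_trans sZ (subD1set _ _).
Qed.

End Split.

(** Induction on [p + q], with [X] as crossing and [N] as nesting. A bounded unsplittable [F0] sorts
    the rest of [F] by the set [Z] of members of [F0] crossed. For a badly splittable class [W],
    [not_split] finds a rainbow in [Z], crossing all of [W], or a twist in [F0 :\: Z], nesting with
    all of [W]; it becomes one more block for the pattern found in [W]. *)
Theorem dichotomous_split t p q : exists n : nat,
  forall (T : finType) (X N : rel T), symmetric X -> symmetric N ->
  forall F : {set T}, dichotomous X N F ->
  [\/ splittable X N n F, thick N X t p F | thick X N t q F].
Proof.
move E: (p + q) => m; elim: m p q E => [|m IH] p q E.
  have -> : p = 0 by lia.
  by exists 0 => T X N symX symN F dF; apply: Or32; apply: thick0.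
case: p E => [|p] E; first by exists 0 => T X N symX symN F dF; apply: Or32; apply: thick0.
case: q E => [|q] E; first by exists 0 => T X N symX symN F dF; apply: Or33; apply: thick0.
have [|n1 h1] := IH p q.+1; first lia.
have [|n2 h2] := IH p.+1 q; first lia.
pose z := local_size t.
(* [2 * t] serves the locally splittable case; otherwise [z] pays for [F0] and [2 ^ z] bounds the
   number of classes. *)
exists (maxn (2 * t) (z + 2 ^ z * maxn n1 n2)) => T X N symX symN F dF.
case: (boolP [forall Z : {set T},
    (Z \subset F) && (#|Z| <= z) ==> splittable X N t Z]) => [/forallP loc|].
  apply: Or31; apply: splitS (leq_maxl _ _) (split_local symX symN dF _) => // Z sZ cZ.
  by move/implyP: (loc Z); rewrite sZ; apply.
case/forallPn => F0; rewrite negb_imply => /andP[/andP[sF0 cF0] ns0].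
pose cls (Z : {set T}) := [set e in F :\: F0 | [set v in F0 | X v e] == Z] : {set T}.
case: (boolP [forall Z in powerset F0, splittable X N (maxn n1 n2) (cls Z)])
  => [/forall_inP hZ|].
  apply: Or31; pose s := [seq cls Z | Z <- enum (powerset F0)].
  have hs : splittable X N (size s * maxn n1 n2) (\bigcup_(Z <- s) Z).
    apply: split_bigcup => // Y /mapP[Z]; rewrite mem_enum => /hZ h ->; exact: h.
  have sizes : size s <= 2 ^ z.
    by rewrite size_map -cardE card_powerset leq_exp2l.
  apply: splitS (leq_trans _ (leq_maxr _ _)) (splitU (split_card X N F0) hs).
    apply/subsetP => e eF; rewrite inE; case: (boolP (e \in F0)) => //= eF0.
    rewrite big_map; rewrite big_enum /=; apply/bigcupP.
    exists [set v in F0 | X v e]; last by rewrite inE inE eF0 eF eqxx.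
    by rewrite powersetE; apply/subsetP => v; rewrite inE => /andP[].
  by rewrite leq_add // leq_mul.
case/forall_inPn => Z; rewrite powersetE => sZ nsW.
set W := cls Z in nsW.
have sWF : W \subset F by apply/subsetP => e; rewrite !inE => /andP[/andP[_ ->]].
have sZF := subset_trans sZ sF0.
have dW := dichotomousS sWF dF.
have WX : {in Z & W, forall e f, X e f}.
  move=> e f eZ; rewrite inE => /andP[_ /eqP EZ].
  by move: eZ; rewrite -EZ inE => /andP[].
have WN : {in F0 :\: Z & W, forall e f, N e f}.
  move=> e f; rewrite inE => /andP[neZ eF0]; rewrite !inE => /andP[/andP[nfF0 fF] /eqP EZ].
  have : X e f || N e f.
    apply: dF => //; first exact: (subsetP sF0).
    by apply: contraNneq nfF0 => <-.
  by case/orP => // Xef; move: neZ; rewrite -EZ inE eF0 Xef.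
have sub0 (C : {set T}) : C \subset F0 -> C \subset F by move=> sC; apply: subset_trans sC sF0.
case: (not_split sZ ns0) => -[C [sC hC tC]].
  have [h|h|h] := h2 T X N symX symN W dW.
  - by case/negP: nsW; apply: splitS (leq_maxr _ _) h.
  - by apply: Or32; apply: thickS h.
  - apply: Or33; apply: thick_extend symN _ sWF (ltnW tC) hC _ h.
      by apply: sub0; apply: subset_trans sC (subsetDl _ _).
    by move=> e f /(subsetP sC); apply: WN.
have [h|h|h] := h1 T X N symX symN W dW.
- by case/negP: nsW; apply: splitS (leq_maxl _ _) h.
- apply: Or32; apply: thick_extend symX _ sWF (ltnW tC) hC _ h.
    by apply: sub0; apply: subset_trans sC sZ.
  by move=> e f /(subsetP sC); apply: WX.
- by apply: Or33; apply: thickS h.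
Qed.

(** * Interval families *)

Record intervals := Intervals {
  carrier :> finType;
  lft : carrier -> nat;
  rgt : carrier -> nat;
  lft_lt_rgt : forall e, lft e < rgt e;
  endpoints_neq : forall e f, e != f ->
    [/\ lft e <> lft f, rgt e <> rgt f & lft e <> rgt f]
}.

Section Intervals.
Variable I : intervals.
Implicit Types (e f : I) (A B C F G : {set I}).

Definition icross e f : bool :=
  [&& lft e < lft f, lft f < rgt e & rgt e < rgt f]
  || [&& lft f < lft e, lft e < rgt f & rgt f < rgt e].

Definition inest e f : bool :=
  [&& lft e < lft f, lft f < rgt f & rgt f < rgt e]
  || [&& lft f < lft e, lft e < rgt e & rgt e < rgt f].

Lemma icross_sym : symmetric icross. Proof. by move=> e f; apply: orbC. Qed.
Lemma inest_sym : symmetric inest. Proof. by move=> e f; apply: orbC. Qed.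
Lemma icross_irr : irreflexive icross. Proof. by move=> e; rewrite /icross ltnn. Qed.

Definition pierced F := [forall e in F, forall f in F, lft e < rgt f].

Lemma piercedP F : reflect {in F &, forall e f, lft e < rgt f} (pierced F).
Proof.
apply: (iffP forall_inP) => [h e f eF | h e eF].
  by move/forall_inP: (h _ eF); apply.
by apply/forall_inP => f; apply: h.
Qed.

Lemma pierced_dichotomous F : pierced F -> dichotomous icross inest F.
Proof.
move=> /piercedP pF e f eF fF ne; have := pF _ _ eF fF; have := pF _ _ fF eF.
have [] := endpoints_neq ne; have := lft_lt_rgt e; have := lft_lt_rgt f.
rewrite /icross /inest; lia.
Qed.

Lemma pierced_colorable k F :
  pierced F -> clique_le icross k F -> colorable icross k F.
Proof.
move=> /piercedP pF hk; pose S e f := (lft e < lft f) && (rgt e < rgt f).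
apply: (chain_colorable (S := S)).
- by move=> e f g; rewrite /S; lia.
- by move=> e; rewrite /S ltnn.
- by move=> e f; rewrite /S /icross; lia.
apply/clique_leP => C sC /cliqueP hC; move/clique_leP: hk; apply=> //.
apply/cliqueP => e f eC fC /(hC _ _ eC fC).
have := pF _ _ (subsetP sC _ eC) (subsetP sC _ fC).
have := pF _ _ (subsetP sC _ fC) (subsetP sC _ eC).
by rewrite /S /icross; lia.
Qed.

Lemma inest_colorable k F : clique_le inest k F -> colorable inest k F.
Proof.
move=> hk; pose S e f := (lft e < lft f) && (rgt f < rgt e).
apply: (chain_colorable (S := S)).
- by move=> e f g; rewrite /S; lia.
- by move=> e; rewrite /S ltnn.
- by move=> e f; rewrite /S /inest; lia.
apply/clique_leP => C sC /cliqueP hC; move/clique_leP: hk; apply=> //.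
apply/cliqueP => e f eC fC /(hC _ _ eC fC).
by rewrite /S /inest; have := lft_lt_rgt e; have := lft_lt_rgt f; lia.
Qed.

(* Abstracts splittable and colorable: pieces that neither cross nor nest with *)
(* one another cost no more together than the worst of them.                   *)
Record local_measure (P : nat -> {set I} -> bool) : Prop := LocalMeasure {
  measureS : forall j k A B, A \subset B -> j <= k -> P j B -> P k A;
  measure0 : P 0 set0;
  measure1 : forall e, P 1 [set e];
  measureU : forall a b A B, P a A -> P b B -> P (a + b) (A :|: B);
  measure_glue : forall k F (kap : I -> nat),
    {in F &, forall e f, icross e f || inest e f -> kap e = kap f} ->
    (forall i, P k [set e in F | kap e == i]) -> P k F
}.

Lemma split_local_measure : local_measure (splittable icross inest).
Proof.
split.
- by move=> j k A B; apply: splitS.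
- by have := split_card icross inest (set0 : {set I}); rewrite cards0.
- by move=> e; have := split_card icross inest [set e]; rewrite cards1.
- by move=> a b A B; apply: splitU.
- by move=> k F kap; apply: split_glue.
Qed.

Lemma colorable_local_measure : local_measure (colorable icross).
Proof.
split.
- by move=> j k A B; apply: colorableS.
- exact: colorable0.
- by move=> e; apply: colorable_set1 icross_irr _.
- by move=> a b A B; apply: colorableU.
- by move=> k F kap h; apply: colorable_glue => e f eF fF ef; apply: h; rewrite ?ef.
Qed.

(** * Cutting the line into segments *)

Section Measure.
Variables (P : nat -> {set I} -> bool) (measP : local_measure P).

Lemma measure_classes n k F (kap : I -> nat) :
  {in F, forall e, kap e < n} ->
  (forall i, P k [set e in F | kap e == i]) -> P (n * k) F.
Proof.
move=> hn hk; have -> : F = [set e in F | kap e < n].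
  by apply/setP => e; rewrite inE; case: (boolP (e \in F)) => // /hn ->.
elim: {hn}n => [|n IH].
  by apply: measureS (measure0 measP) => //; apply/subsetP => e; rewrite inE andbF.
rewrite mulSn; apply: (measureS measP) (measureU measP (hk n) IH) => //.
by apply/subsetP => e; rewrite !inE ltnS leq_eqVlt; case: (e \in F).
Qed.

(** Classes are formed by the number of segments advanced and by the starting segment modulo
    [w + 1]. Within a class, intervals with the same starting segment all pass its end, hence are
    pierced; the others start more than [w] segments apart, hence are disjoint. *)
Lemma measure_short (sig : nat -> nat) w k F :
  {homo sig : x y / x <= y} ->
  (forall G, G \subset F -> pierced G -> P k G) ->
  {in F, forall e, sig (lft e) < sig (rgt e) <= sig (lft e) + w} ->
  P (w * (w.+1 * k)) F.
Proof.
move=> mono hk hw.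
apply: (measure_classes (kap := fun e => (sig (rgt e) - sig (lft e)).-1)).
  by move=> e /hw; lia.
move=> i; set F1 := [set e in F | _].
apply: (measure_classes (kap := fun e => sig (lft e) %% w.+1)).
  by move=> e _; rewrite ltn_mod.
move=> j; set F2 := [set e in F1 | _].
apply: (measure_glue measP (kap := fun e => sig (lft e))) => [e f|x].
  rewrite !inE => /andP[/andP[/hw we _] /eqP je] /andP[/andP[/hw wf _] /eqP jf].
  rewrite -je in jf; move/eqP: jf => jf ef.
  have [ltef|ltfe|//] := ltngtP (sig (lft e)) (sig (lft f)).
    move: jf; rewrite eqn_mod_dvd ?(ltnW ltef) // => /dvdn_leq.
    rewrite subn_gt0 ltef => /(_ isT) far.
    have := mono (lft f) (rgt e); move: ef; rewrite /icross /inest.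
    have := lft_lt_rgt e; have := lft_lt_rgt f; lia.
  move: jf; rewrite eq_sym eqn_mod_dvd ?(ltnW ltfe) // => /dvdn_leq.
  rewrite subn_gt0 ltfe => /(_ isT) far.
  have := mono (lft e) (rgt f); move: ef; rewrite /icross /inest.
  have := lft_lt_rgt e; have := lft_lt_rgt f; lia.
apply: hk.
  by apply/subsetP => e; rewrite !inE => /andP[/andP[/andP[]]].
apply/piercedP => e f; rewrite !inE => /andP[/andP[/andP[/hw we _] _] /eqP xe].
move=> /andP[/andP[/andP[/hw wf _] _] /eqP xf].
have := mono (rgt f) (lft e); lia.
Qed.

End Measure.

(** [c] lists the cut points, each the least one for which [B] holds on the segment it closes, and
    [sig x] is the index of the segment containing [x]. Cuts from [n] on are always allowed, which
    makes the search total. *)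
Lemma greedy_cuts (B : nat -> nat -> nat -> bool) (n : nat) :
  exists c sig : nat -> nat,
  [/\ {homo sig : x y / x <= y},
      forall x, c (sig x) <= x < c (sig x).+1,
      forall i x, (i < sig x -> c i.+1 <= x) /\ (sig x < i -> x < c i),
      forall i x, x < n -> i < sig x -> B i (c i) (c i.+1)
    & forall i y, c i < y < c i.+1 -> ~~ B i (c i) y].
Proof.
have exN i a : exists y, (a < y) && (B i a y || (n <= y)).
  by exists (maxn a.+1 n); rewrite !leq_max !leqnn !orbT.
pose nxt i a := ex_minn (exN i a).
pose c := fix c i := if i is j.+1 then nxt j (c j) else 0.
have cS i : c i < c i.+1 by rewrite /= /nxt; case: ex_minnP => y /andP[].
have cmono : {homo c : i j / i < j} by apply: homo_ltn ltn_trans cS.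
have cle : {homo c : i j / i <= j} by apply: ltnW_homo.
have cge i : i <= c i by elim: i => // i; move: (cS i); lia.
have exS x : exists i, x < c i.+1 by exists x; apply: cge x.+1.
pose sig x := ex_minn (exS x).
have sigP x : c (sig x) <= x < c (sig x).+1.
  rewrite /sig; case: ex_minnP => [[|i]] h1 h2; rewrite h1 andbT //.
  by rewrite leqNgt; apply/negP => /h2; rewrite ltnn.
have below i x : i < sig x -> c i.+1 <= x.
  by move=> lti; have /andP[h _] := sigP x; apply: leq_trans (cle _ _ lti) h.
exists c, sig; split=> //.
- move=> x y xy; rewrite leqNgt; apply/negP => /below h.
  by have := sigP y; lia.
- move=> i x; split; first exact: below.
  by move=> /cle; have /andP[_ h] := sigP x; apply: leq_trans.
- move=> i x xn /below; rewrite /= /nxt; case: ex_minnP => y /andP[_ h] _ yx.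
  by case/orP: h => //; lia.
- move=> i y; rewrite /= /nxt; case: ex_minnP => z /andP[_ h] hmin /andP[h1 h2].
  by apply/negP => By; have := hmin y; rewrite h1 By => /(_ isT); lia.
Qed.

Definition segment F a b := [set e in F | (a <= lft e) && (rgt e < b)].

(** The line is cut into minimal segments on which [P m] fails. Intervals inside one segment cost
    [m + 1], those reaching the next segment cost [2 * k], and any longer one passes over a whole
    segment where [P m] fails. *)
Lemma segmentation P m k F : local_measure P ->
  (forall G, G \subset F -> pierced G -> P k G) ->
  exists c sig : nat -> nat,
  [/\ {homo sig : x y / x <= y},
      P (m.+1 + 2 * k) [set e in F | sig (rgt e) <= (sig (lft e)).+1]
    & {in F, forall e i, sig (lft e) < i < sig (rgt e) ->
        [/\ ~~ P m (segment F (c i) (c i.+1)), lft e < c i & c i.+1 <= rgt e]}].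
Proof.
move=> measP hk.
pose n := (\max_(e : I) rgt e).+1.
have ltn_n e : rgt e < n by rewrite ltnS; exact: (leq_bigmax (F := @rgt I)).
have [c [sig [mono sigP cP hB hnB]]] :=
  greedy_cuts (fun i a y => ~~ P m (segment F a y)) n.
exists c, sig; split=> //; last first.
  move=> e eF i /andP[lti ltir]; split; first exact: hB ltir.
    exact: (cP i (lft e)).2.
  exact: (cP i (rgt e)).1.
pose F0 := [set e in F | sig (rgt e) == sig (lft e)].
pose F1 := [set e in F | sig (rgt e) == (sig (lft e)).+1].
apply: (measureS measP) (measureU measP (A := F0) (B := F1) _ _) => //.
- apply/subsetP => e; rewrite !inE; have := mono _ _ (ltnW (lft_lt_rgt e)).
  by case: (e \in F) => //=; lia.
- apply: (measure_glue measP (kap := fun e => sig (lft e))) => [e f|i].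
    rewrite !inE => /andP[_ /eqP he] /andP[_ /eqP hf] ef.
    have := mono (lft e) (rgt f); have := mono (lft f) (rgt e); move: ef.
    have := lft_lt_rgt e; have := lft_lt_rgt f; rewrite /icross /inest; lia.
  (* Minimality gives [P m] only for intervals ending before the last point [y] of the segment; at
     most one interval ends at [y], and it pays for the extra 1. *)
  pose y := (c i.+1).-1; pose R := [set e in F0 | rgt e == y].
  have PR : P 1 R.
    have [->|[e]] := set_0Vmem R; first by apply: measureS (measure0 measP).
    rewrite inE => /andP[_ /eqP ey].
    apply: (measureS measP) (measure1 measP e) => //; apply/subsetP => f.
    rewrite !inE => /andP[_ /eqP fy]; apply: contraT => /endpoints_neq[_].
    by rewrite ey fy.
  have Py : P m (segment F (c i) y).
    have := hnB i y; case: (ltnP (c i) y) => [ciy|yci _].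
      by rewrite /y in ciy *; case: (P _ _) => //; lia.
    apply: (measureS measP) (measure0 measP) => //; apply/subsetP => e.
    by rewrite !inE; have := lft_lt_rgt e; lia.
  rewrite -add1n; apply: (measureS measP) (measureU measP PR Py) => //.
  apply/subsetP => e; rewrite !inE => /andP[/andP[eF /eqP er] /eqP ei].
  rewrite eF er ei eqxx /= /y; have := sigP (lft e); have := sigP (rgt e).
  by rewrite er ei; lia.
- rewrite -[2]/(1 * 2) -mulnA; apply: (measure_short measP mono) => [G sG|e].
    by apply: hk; apply: subset_trans sG _; apply/subsetP => e; rewrite inE => /andP[].
  by rewrite inE => /andP[_]; lia.
Qed.

(* The segment i is the one containing the last left endpoint of the twist, or *)
(* one of its two neighbors.                                                   *)
Lemma long_twist (sig : nat -> nat) t C :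
  {homo sig : x y / x <= y} -> clique icross C ->
  {in C, forall e, (sig (lft e)).+1 < sig (rgt e)} -> 3 * t < #|C| ->
  exists (i : nat) (D : {set I}), [/\ D \subset C, t <= #|D|
                & {in D, forall e, sig (lft e) < i < sig (rgt e)}].
Proof.
move=> mono /cliqueP hC hl tC.
have /card_gt0P[e1 e1C] : 0 < #|C| by lia.
have [e0 e0C hmax] := arg_maxnP (fun e => lft e) e1C.
pose g := sig (lft e0).
pose D j := [set e in C | sig (lft e) < g + j - 1 < sig (rgt e)].
have hg : {in C, forall e, sig (lft e) <= g <= sig (rgt e)}.
  move=> e eC; apply/andP; split; apply: mono; [exact: hmax | apply: ltnW].
  have [<-|ne] := eqVneq e0 e; first exact: lft_lt_rgt.
  by have := hC _ _ e0C eC ne; rewrite /icross; have := lft_lt_rgt e; lia.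
have cov : C \subset D 0 :|: (D 1 :|: D 2).
  apply/subsetP => e eC; rewrite !inE eC /=; have := hg _ eC; have := hl _ eC; lia.
have : #|C| <= #|D 0| + (#|D 1| + #|D 2|).
  apply: leq_trans (subset_leq_card cov) _.
  by apply: leq_trans (leq_card_setU _ _) _; rewrite leq_add2l leq_card_setU.
have sD j : D j \subset C by apply/subsetP => e; rewrite inE => /andP[].
have hD j : {in D j, forall e, sig (lft e) < g + j - 1 < sig (rgt e)}.
  by move=> e; rewrite inE => /andP[].
move=> cD; case: (leqP t #|D 0|) => h0; first by exists (g + 0 - 1), (D 0).
case: (leqP t #|D 1|) => h1; first by exists (g + 1 - 1), (D 1).
by exists (g + 2 - 1), (D 2); split=> //; lia.
Qed.

End Intervals.

(** Induction on [p]. If the intervals passing over a whole segment contain no large twist, they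
    join the part with bounded twists. Otherwise [t] members of a twist pass over a common segment
    that is not [n]-splittable, and they nest with the whole thick rainbow found there by
    induction. *)
Theorem intervals_split t p : exists n : nat, forall (I : intervals) (F : {set I}),
  [\/ splittable (@icross I) (@inest I) n F,
      thick (@inest I) (@icross I) t t F | thick (@icross I) (@inest I) t p F].
Proof.
elim: p => [|p [n IH]]; first by exists 0 => I F; apply: Or33; apply: thick0.
have [n1 h1] := dichotomous_split t t p.+1.
exists ((n.+1 + 2 * n1) + 3 * t) => I F.
have h1I := h1 I _ _ (@icross_sym I) (@inest_sym I).
case: (boolP [exists G : {set I}, [&& G \subset F, pierced G &
    ~~ splittable (@icross I) (@inest I) n1 G]]) => [/existsP[G /and3P[sG pG nG]]|].
  have [h|h|h] := h1I G (pierced_dichotomous pG); first by rewrite h in nG.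
    by apply: Or32; apply: thickS h.
  by apply: Or33; apply: thickS h.
rewrite negb_exists => /forallP hG.
have {}hG (G : {set I}) : G \subset F -> pierced G ->
    splittable (@icross I) (@inest I) n1 G.
  by move=> sG pG; move: (hG G); rewrite sG pG negbK.
have [c [sig [mono hs hl]]] := segmentation n (split_local_measure I) hG.
set F0 := [set e in F | _] in hs; pose L := F :\: F0.
case hL: (clique_le (@icross I) (3 * t) L).
  apply: Or31; apply: splitS (splitU hs (split_clique_leX (@inest I) hL)) => //.
  by apply/subsetP => e eF; rewrite !inE eF /=; case: leqP.
have /clique_le_gtP[C [sC hC tC]] := negbT hL.
have longC : {in C, forall e, (sig (lft e)).+1 < sig (rgt e)}.
  by move=> e /(subsetP sC); rewrite !inE ltnNge => /andP[+ eF]; rewrite eF.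
have sCF : C \subset F by apply: subset_trans sC (subsetDl _ _).
have [i [D [sD tD hD]]] := long_twist mono hC longC tC.
have sDF := subset_trans sD sCF.
have covD : {in D, forall e, [/\ ~~ splittable (@icross I) (@inest I) n
    (segment F (c i) (c i.+1)), lft e < c i & c i.+1 <= rgt e]}.
  by move=> e eD; apply: hl (hD _ eD); apply: (subsetP sDF).
have sW : segment F (c i) (c i.+1) \subset F.
  by apply/subsetP => e; rewrite inE => /andP[].
have [h|h|h] := IH I (segment F (c i) (c i.+1)).
- have [D0|[e /covD[]]] := set_0Vmem D; last by rewrite h.
  move: tD; rewrite D0 cards0 leqn0 => /eqP->; apply: Or32; exact: thick0.
- by apply: Or32; apply: thickS h.
- apply: Or33; apply: thick_extend (@inest_sym I) sDF sW tD (cliqueS sD hC) _ h.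
  move=> e f /covD[_ h1' h2']; rewrite inE /inest => /and3P[_ h3 h4].
  by have := lft_lt_rgt f; lia.
Qed.

(** * Crossing graphs are chi-bounded *)

Section TwistFree.
Variable I : intervals.
Implicit Types (e f : I) (A B C F G M K : {set I}).

Definition window_monotone (W : nat -> nat -> bool) :=
  forall x' x y y', x' <= x -> y <= y' -> W x y -> W x' y'.

(* Cut greedily, alternately after a window in W1 and after a window in W2: an *)
(* interval containing no W1-window followed by a W2-window meets few pieces.  *)
Lemma windows_colorable (W1 W2 : nat -> nat -> bool) t B :
  window_monotone W1 -> window_monotone W2 ->
  {in B, forall e, [/\ W1 (lft e) (rgt e), W2 (lft e) (rgt e)
                    & forall z, lft e <= z <= rgt e -> ~~ (W1 (lft e) z && W2 z (rgt e))]} ->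
  clique_le (@icross I) t B -> colorable (@icross I) (3 * (4 * t)) B.
Proof.
move=> mon1 mon2 hB ht.
pose n := (\max_(e : I) rgt e).+1.
have ltn_n e : rgt e < n by rewrite ltnS; exact: (leq_bigmax (F := @rgt I)).
have [c [sig [mono sigP cP hc hnc]]] :=
  greedy_cuts (fun i => if odd i then W2 else W1) n.
(* Used with [w = 3]: it remains to see that each interval advances one to three segments. *)
apply: (measure_short (colorable_local_measure I) mono) => [G sG pG|e eB].
  by apply: pierced_colorable => //; apply: clique_leS ht.
have [w1 w2 w12] := hB e eB; have := mono _ _ (ltnW (lft_lt_rgt e)).
have /andP[cl cl'] := sigP (lft e); have /andP[cr cr'] := sigP (rgt e).
rewrite leq_eqVlt => /predU1P[E|ltlr].
  have := hnc (sig (lft e)) (rgt e); rewrite {2}E cr'.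
  rewrite (leq_ltn_trans cl (lft_lt_rgt e)) => /(_ isT).
  by case: ifP => _; [rewrite (mon2 _ _ _ _ cl (leqnn _) w2)
                     |rewrite (mon1 _ _ _ _ cl (leqnn _) w1)].
rewrite ltlr /= leqNgt; apply/negP => far.
(* An interval advancing further covers two consecutive segments starting at an even index, that is,
   a [W1]-window followed by a [W2]-window. *)
have [i [oddi hi1 hi2]] : exists i,
    [/\ odd i = false, sig (lft e) < i & i.+1 < sig (rgt e)].
  case o: (odd (sig (lft e))); [exists (sig (lft e)).+1|exists (sig (lft e)).+2];
  by rewrite /= ?negbK o; split=> //; lia.
have := hc i (rgt e) (ltn_n e); have := hc i.+1 (rgt e) (ltn_n e).
rewrite /= oddi /= => /(_ hi2) v2 /(_ (ltnW hi2)) v1.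
have le1 : lft e <= c i by apply/ltnW/(cP _ _).2/hi1.
have le2 : c i.+2 <= rgt e by apply: (cP _ _).1 hi2.
have zr : lft e <= c i.+1 <= rgt e.
  apply/andP; split; first by apply/ltnW/(cP _ _).2/ltnW.
  by apply: (cP _ _).1; apply: ltnW hi2.
move: (w12 _ zr).
by rewrite (mon1 _ _ _ _ le1 (leqnn _) v1) (mon2 _ _ _ _ (leqnn _) le2 v2).
Qed.

(** * Breadth-first layers of the crossing graph *)

Fixpoint ball F (r0 : I) n : {set I} :=
  if n is m.+1 then
    ball F r0 m :|: [set e in F | [exists f in ball F r0 m, icross f e]]
  else [set r0].

Lemma ballS F r0 n e f :
  f \in ball F r0 n -> e \in F -> icross f e -> e \in ball F r0 n.+1.
Proof.
by move=> fb eF fe; rewrite /= !inE eF; apply/orP; right; apply/exists_inP; exists f.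
Qed.

Lemma ball_sub F r0 n : r0 \in F -> ball F r0 n \subset F.
Proof.
move=> r0F; elim: n => [|n IH] /=; first by rewrite sub1set.
by rewrite subUset IH; apply/subsetP => e; rewrite inE => /andP[].
Qed.

Lemma ball_closed F r0 : exists n, ball F r0 n.+1 = ball F r0 n.
Proof.
have grow k : (exists n, ball F r0 n.+1 = ball F r0 n) \/ k < #|ball F r0 k|.
  elim: k => [|k [IH|IH]]; [by right; rewrite cards1 | by left |].
  have sub : ball F r0 k \subset ball F r0 k.+1 by rewrite /= subsetUl.
  have [E|ne] := eqVneq (ball F r0 k.+1) (ball F r0 k); first by left; exists k.
  right; apply: leq_ltn_trans IH (proper_card _).
  by rewrite properEneq eq_sym ne.
by have [//|] := grow #|I|; rewrite ltnNge max_card.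
Qed.

(** [r0] starts first, so it lies inside no member of [F]. Further out, [f] is crossed by some [g]
    of the previous ball; [g] does not cross [e], which is outside the ball, and is not inside [e]
    by induction. So [g] contains [e] or is disjoint from it, and crosses nothing inside [e]. *)
Lemma not_inside_ball F r0 n e f :
  {in F, forall g, lft r0 <= lft g} -> r0 \in F ->
  f \in ball F r0 n -> e \in F -> e \notin ball F r0 n ->
  ~~ ((lft e < lft f) && (rgt f < rgt e)).
Proof.
move=> hr r0F; elim: n f => [|n IH] f fb eF neb.
  by move: fb; rewrite inE => /eqP->; have := hr _ eF; lia.
have neb' : e \notin ball F r0 n.
  by apply: contra neb => eb; rewrite /= inE eb.
move: fb; rewrite /= inE => /orP[fb|]; first exact: IH.
rewrite inE => /andP[fF /exists_inP[g gb gf]].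
have nge : ~~ icross g e by apply: contra neb; apply: ballS.
have := IH g gb eF neb'.
have /endpoints_neq[] : g != e by apply: contraNneq neb' => <-.
have /endpoints_neq[] : e != g by apply: contraNneq neb' => ->.
move: gf nge; rewrite /icross; have := lft_lt_rgt e; have := lft_lt_rgt f.
have := lft_lt_rgt g; lia.
Qed.

Definition layer F r0 n :=
  if n is m.+1 then ball F r0 n :\: ball F r0 m else ball F r0 0.

(** Distances [d] from [r0] of crossing intervals differ by at most one, so distinct layers of equal
    parity do not cross and share [k] colors. *)
Lemma layers_colorable F r0 k n : r0 \in F ->
  ball F r0 n.+1 = ball F r0 n ->
  (forall i, i <= n -> colorable (@icross I) k (layer F r0 i)) ->
  colorable (@icross I) (2 * k) (ball F r0 n).
Proof.
move=> r0F cl hk; pose d e := find (fun i => e \in ball F r0 i) (iota 0 n.+1).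
have hasd e : e \in ball F r0 n -> has (fun i => e \in ball F r0 i) (iota 0 n.+1).
  by move=> eb; apply/hasP; exists n; rewrite ?mem_iota ?add0n ?ltnSn.
have dle e : e \in ball F r0 n -> d e <= n.
  by move=> /hasd; rewrite has_find size_iota.
have din e : e \in ball F r0 n -> e \in ball F r0 (d e).
  by move=> eb; have := nth_find 0 (hasd e eb); rewrite nth_iota ?ltnS ?dle.
have dmin e i : i < d e -> i <= n -> e \notin ball F r0 i.
  move=> lti len; have := before_find 0 lti.
  by rewrite nth_iota // => ->.
have sub := ball_sub n r0F.
have dstep : {in ball F r0 n &, forall e f, icross e f -> d f <= (d e).+1}.
  move=> e f eb fb ef; rewrite leqNgt; apply/negP => far.
  have : f \in ball F r0 (d e).+1 by apply: ballS ef; [exact: din|exact: (subsetP sub)].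
  by apply/negP/dmin => //; have := dle f fb; lia.
apply: (measure_classes (colorable_local_measure I) (kap := fun e => d e %% 2)).
  by move=> e _; rewrite ltn_mod.
move=> p; apply: (colorable_glue (kap := d)) => [e f|i].
  rewrite !inE => /andP[eb pe] /andP[fb pf] ef.
  have := dstep _ _ eb fb ef; rewrite icross_sym in ef.
  by have := dstep _ _ fb eb ef; move: pe pf; lia.
case: (leqP i n) => [lein|ltni]; last first.
  apply: colorableS (colorable0 _ k) => //; apply/subsetP => e.
  by rewrite !inE => /andP[/andP[/dle + _] /eqP]; lia.
apply: colorableS (hk i lein) => //; apply/subsetP => e.
rewrite !inE => /andP[/andP[eb _] /eqP de]; have := din _ eb; rewrite de.
case: i de lein => [|i] // de lein ei; rewrite /layer inE ei andbT dmin ?de //.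
exact: ltnW.
Qed.

(* Layer the crossing graph by distance from the interval starting first. If a *)
(* layer interval e passes over a segment, then no interval of the previous    *)
(* balls lies inside e, so those crossing intervals of the segment leave it.   *)
Lemma colorable_or_exits m t F :
  clique_le (@icross I) t F ->
  ~~ colorable (@icross I) (2 * (m.+1 + 2 * t)) F ->
  exists a b M,
    [/\ M \subset F, {in M, forall e, (a <= lft e) && (rgt e < b)},
        ~~ colorable (@icross I) m M
      & {in M, forall e, exists2 f, f \in F &
           icross f e && ~~ ((a <= lft f) && (rgt f < b))}].
Proof.
set k := m.+1 + 2 * t.
move E: #|F| => n; elim/ltn_ind: n F E => n IH F E ht hF.
have [F0|[e1 e1F]] := set_0Vmem F.
  by rewrite F0 colorable0 in hF.
have [r0 r0F hmin] := arg_minnP (fun e => lft e) e1F.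
have {}hmin : {in F, forall g, lft r0 <= lft g} by move=> g; apply: hmin.
have [n0 cl] := ball_closed F r0; pose K := ball F r0 n0.
have sK : K \subset F := ball_sub n0 r0F.
(* [K] is the component of [r0]. If the rest is hard to color, the induction hypothesis applies to
   it; otherwise [K] itself is hard, since components share colors. *)
case hU: (colorable (@icross I) (2 * k) (F :\: K)); last first.
  have r0K : r0 \in K.
    by rewrite /K; elim: {cl K sK hU}n0 => [|j IHj] /=; rewrite inE ?eqxx ?IHj.
  have ltU : #|F :\: K| < n.
    rewrite -E; apply: proper_card; rewrite properE subsetDl /=.
    by apply/subsetPn; exists r0; rewrite // inE r0K.
  have htU : clique_le (@icross I) t (F :\: K).
    by apply: clique_leS ht; rewrite ?subsetDl.
  have [a [b [M [h1 h2 h3 h4]]]] := IH _ ltU _ (erefl _) htU (negbT hU).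
  exists a, b, M; split=> // [|e /h4[f fU hf]].
    by apply: subset_trans h1 (subsetDl _ _).
  by exists f => //; move: fU; rewrite inE => /andP[].
case hL: [forall i : 'I_n0.+1, colorable (@icross I) k (layer F r0 i)].
  case/negP: hF.
  have hK : colorable (@icross I) (2 * k) K.
    apply: layers_colorable => // i lein.
    by move/forallP: hL => /(_ (Ordinal (lein : i < n0.+1))).
  apply: (colorable_glue (kap := fun e => nat_of_bool (e \in K))) => [e f eF fF ef|i].
    have clK g h : g \in F -> h \in F -> icross g h -> g \in K -> h \in K.
      by move=> gF hF gh gK; rewrite /K -cl; apply: ballS gh.
    congr nat_of_bool; apply/idP/idP; first exact: clK ef.
    by apply: clK; rewrite // icross_sym.
  case: i => [|i]; [apply: colorableS hU | apply: colorableS hK] => //;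
    by apply/subsetP => e; rewrite !inE => /andP[eF]; case: (e \in _).
have /forallPn[[x ltx] /= nL] := negbT hL.
case: x ltx nL => [|x] ltx nL.
  by case/negP: nL; apply: colorable_set1 (@icross_irr I) _; rewrite /k; lia.
set L := layer F r0 x.+1 in nL.
have sL : L \subset F.
  by apply: subset_trans (subsetDl _ _) (ball_sub _ r0F).
have hp G : G \subset L -> pierced G -> colorable (@icross I) t G.
  move=> sG pG; apply: pierced_colorable => //.
  by apply: clique_leS ht; rewrite ?(subset_trans sG).
have [c [sig [mono hs hl]]] := segmentation m (colorable_local_measure I) hp.
have [e eL le] : exists2 e, e \in L & (sig (lft e)).+1 < sig (rgt e).
  apply/exists_inP; apply: contraR nL; rewrite negb_exists => /forallP h.
  apply: colorableS hs => //; apply/subsetP => e eL; rewrite inE eL /=.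
  by move: (h e); rewrite eL /= -leqNgt.
have [|nM le1 le2] := hl e eL (sig (lft e)).+1; first by rewrite ltnSn.
exists (c (sig (lft e)).+1), (c (sig (lft e)).+2).
exists (segment L (c (sig (lft e)).+1) (c (sig (lft e)).+2)).
split=> //.
- by apply: subset_trans sL; apply/subsetP => g; rewrite inE => /andP[].
- by move=> g; rewrite inE => /andP[].
move=> g; rewrite inE => /andP[gL hg].
have : exists2 f, f \in ball F r0 x & icross f g.
  move: gL; rewrite inE => /andP[ng]; rewrite /= inE (negbTE ng) /= inE.
  by case/andP=> _ /exists_inP.
case=> f fb fg; exists f; first exact: (subsetP (ball_sub x r0F)).
rewrite fg /=.
have : e \notin ball F r0 x by move: eL; rewrite inE => /andP[].
move/(not_inside_ball hmin r0F fb (subsetP sL _ eL)); apply: contra => /andP[h1 h2].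
by rewrite (leq_trans le1 h1) (leq_trans h2 le2).
Qed.

(** The members admitting no such [z] fall under [windows_colorable] and cost only [3 * (4 * t)]
    colors. *)
Lemma windows_in_order (W1 W2 : nat -> nat -> bool) t m M :
  window_monotone W1 -> window_monotone W2 ->
  {in M, forall e, W1 (lft e) (rgt e) && W2 (lft e) (rgt e)} ->
  clique_le (@icross I) t M -> ~~ colorable (@icross I) (m + 3 * (4 * t)) M ->
  exists M', [/\ M' \subset M, ~~ colorable (@icross I) m M'
    & {in M', forall e, exists2 z, lft e <= z <= rgt e & W1 (lft e) z && W2 z (rgt e)}].
Proof.
move=> mon1 mon2 hM ht nM.
pose good e := [exists z : 'I_(rgt e).+1,
  (lft e <= z) && (W1 (lft e) z && W2 z (rgt e))].
pose M' := [set e in M | good e].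
exists M'; split.
- by apply/subsetP => e; rewrite inE => /andP[].
- apply: contra nM => hM'.
  have sB : M :\: M' \subset M by rewrite subsetDl.
  have hB : colorable (@icross I) (3 * (4 * t)) (M :\: M').
    apply: windows_colorable mon1 mon2 _ (clique_leS sB (leqnn t) ht) => e.
    rewrite !inE => /andP[+ eM]; rewrite eM /= negb_exists => /forallP h.
    have /andP[-> ->] := hM e eM; split=> // z /andP[lez zr].
    by have := h (Ordinal (zr : z < (rgt e).+1)); rewrite /= lez.
  apply: colorableS (colorableU hM' hB) => //.
  by apply/subsetP => e eM; rewrite inE in_setD eM andbT orbN.
- move=> e; rewrite inE => /andP[_ /existsP[z /andP[lez hz]]]; exists z => //.
  by rewrite lez -ltnS ltn_ord.
Qed.

(** When the window from [x] to [y] is spanned by another interval inside the segment from [a] to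
    [b], entering it forces a crossing with that interval. *)
Definition enters a b x y e :=
  ((x <= lft e < y) && ~~ (a <= rgt e < b)) ||
  ((x <= rgt e < y) && ~~ (a <= lft e < b)).

Definition twist_enters j F a b x y :=
  [exists K : {set I}, [&& K \subset F, clique (@icross I) K, #|K| == j
                         & [forall g in K, enters a b x y g]]].

Lemma twist_enters_monotone j F a b : window_monotone (twist_enters j F a b).
Proof.
move=> x' x y y' xx yy /existsP[K /and4P[h1 h2 h3 /forall_inP h4]].
apply/existsP; exists K; rewrite h1 h2 h3 /=; apply/forall_inP => g /h4.
rewrite /enters; lia.
Qed.

Lemma twist_enters_extend j F a b a' b' x y x' y' K f :
  a <= a' -> b' <= b -> x <= x' -> y' <= y ->
  K \subset F -> clique (@icross I) K -> #|K| = j ->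
  {in K, forall g, enters a b x' y' g && icross f g} ->
  f \in F -> (a <= lft f) && (rgt f < b) -> enters a' b' x y f ->
  twist_enters j.+1 F a' b' x y.
Proof.
move=> aa bb xx yy sK cK jK hK fF fab ef; apply/existsP; exists (f |: K).
apply/and4P; split.
- by rewrite subUset sub1set fF.
- by apply: clique_setU1 => // [|g /hK /andP[]//]; apply: icross_sym.
- rewrite cardsU1 jK; case: (boolP (f \in K)) => // /hK.
  by rewrite icross_irr andbF.
- apply/forall_inP => g /setU1P[->//|/hK /andP[+ _]].
  by rewrite /enters; have := lft_lt_rgt g; lia.
Qed.

End TwistFree.

(** Induction on [j]. [colorable_or_exits] yields a subsegment whose members are each crossed by
    some [f] leaving it; those with [f] leaving to the right, or those with [f] leaving to the left,
    stay hard to color. To cross the whole [j]-twist, [f] must have its endpoint inside [e] before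
    those of the twist when it leaves to the right, and after them when it leaves to the left;
    [windows_in_order] arranges this. *)
Lemma colorable_or_twist_enters t j m : exists n, forall (I : intervals) (F : {set I}),
  clique_le (@icross I) t F -> ~~ colorable (@icross I) n F ->
  exists a b (M : {set I}),
    [/\ M \subset F, {in M, forall e, (a <= lft e) && (rgt e < b)},
        ~~ colorable (@icross I) m M
      & {in M, forall e, twist_enters j F a b (lft e) (rgt e)}].
Proof.
elim: j m => [|j IH] m.
  exists m => I F _ nF; exists 0, (\max_(e : I) rgt e).+1, F; split=> //.
    by move=> e _; rewrite ltnS; exact: (leq_bigmax (F := @rgt I)).
  move=> e _; apply/existsP; exists set0; rewrite sub0set cards0 eqxx /=.
  by apply/andP; split; [apply/cliqueP => g h|apply/forall_inP => g]; rewrite inE.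
pose m1 := m + 3 * (4 * t).
have [n hn] := IH (2 * ((m1 + m1).+1 + 2 * t)); exists n => I F ht nF.
have [a [b [M [sM Mab nM twM]]]] := hn I F ht nF.
have htM := clique_leS sM (leqnn t) ht.
have [a1 [b1 [M1 [sM1 M1ab nM1 exM1]]]] := colorable_or_exits htM nM.
pose a' := maxn a a1; pose b' := minn b b1.
have M1ab' e : e \in M1 -> (a' <= lft e) && (rgt e < b').
  move=> eM1; have := M1ab e eM1; have := Mab e (subsetP sM1 _ eM1).
  by rewrite /a' /b'; clear; lia.
pose WR x y := [exists f in M, (x <= lft f < y) && (b' <= rgt f)].
pose WL x y := [exists f in M, (x <= rgt f < y) && (lft f < a')].
have monR : window_monotone WR.
  move=> x' x y y' xx yy /exists_inP[f fM hf]; apply/exists_inP; exists f => //.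
  by move: xx yy hf; clear; lia.
have monL : window_monotone WL.
  move=> x' x y y' xx yy /exists_inP[f fM hf]; apply/exists_inP; exists f => //.
  by move: xx yy hf; clear; lia.
pose MR := [set e in M1 | WR (lft e) (rgt e)].
pose ML := [set e in M1 | WL (lft e) (rgt e)].
have sMR : MR \subset M1 by apply/subsetP => e; rewrite inE => /andP[].
have sML : ML \subset M1 by apply/subsetP => e; rewrite inE => /andP[].
have cov : M1 \subset MR :|: ML.
  apply/subsetP => e eM1; rewrite !inE eM1 /=; have [f fM /andP[ef out]] := exM1 e eM1.
  have {out} : (lft f < a1) || (b1 <= rgt f) by move: out; clear; lia.
  case/orP=> out; apply/orP; [right|left]; apply/exists_inP; exists f => //;
  by move: ef out (M1ab e eM1); rewrite /icross /a' /b'; clear; lia.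
have tw := @twist_enters_monotone I j F a b.
case hR: (colorable (@icross I) m1 MR); last first.
  have wMR : {in MR, forall e, WR (lft e) (rgt e) && twist_enters j F a b (lft e) (rgt e)}.
    by move=> e; rewrite inE => /andP[eM1 ->]; apply: twM; apply: (subsetP sM1).
  have htMR := clique_leS (subset_trans sMR sM1) (leqnn t) htM.
  have [M2 [sM2 nM2 hM2]] := windows_in_order monR tw wMR htMR (negbT hR).
  have sM21 := subset_trans sM2 sMR.
  exists a', b', M2; split=> // [|e eM2|e eM2].
  + exact: subset_trans sM21 (subset_trans sM1 sM).
  + by apply/M1ab'/(subsetP sM21).
  have [z zr /andP[/exists_inP[f fM hf] /existsP[K hzK]]] := hM2 e eM2.
  have /and4P[sK cK /eqP jK /forall_inP hK] := hzK.
  have eab := M1ab' e (subsetP sM21 _ eM2); have fab := Mab f fM.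
  apply: (twist_enters_extend (a := a) (b := b) (x' := z) (y' := rgt e) (K := K) (f := f)) => //.
  + exact: leq_maxl.
  + exact: geq_minl.
  + by move: hf; clear; lia.
  (* [f] stays inside the old segment and [g] leaves it, so they cross on whichever side [g]
     leaves. *)
  + move=> g gK; move: (hK g gK) eab fab hf (lft_lt_rgt g).
    by rewrite /enters /icross /a' /b'; clear; lia.
  + exact: (subsetP sM).
  + by move: zr hf; rewrite /enters; clear; lia.
have hL : ~~ colorable (@icross I) m1 ML.
  by apply: contra nM1 => hL; apply: colorableS (colorableU hR hL).
have wML : {in ML, forall e, twist_enters j F a b (lft e) (rgt e) && WL (lft e) (rgt e)}.
  by move=> e; rewrite inE => /andP[eM1 ->]; rewrite andbT; apply: twM; apply: (subsetP sM1).
have htML := clique_leS (subset_trans sML sM1) (leqnn t) htM.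
have [M2 [sM2 nM2 hM2]] := windows_in_order tw monL wML htML hL.
have sM21 := subset_trans sM2 sML.
exists a', b', M2; split=> // [|e eM2|e eM2].
+ exact: subset_trans sM21 (subset_trans sM1 sM).
+ by apply/M1ab'/(subsetP sM21).
have [z zr /andP[/existsP[K hzK] /exists_inP[f fM hf]]] := hM2 e eM2.
have /and4P[sK cK /eqP jK /forall_inP hK] := hzK.
have eab := M1ab' e (subsetP sM21 _ eM2); have fab := Mab f fM.
apply: (twist_enters_extend (a := a) (b := b) (x' := lft e) (y' := z) (K := K) (f := f)) => //.
+ exact: leq_maxl.
+ exact: geq_minl.
+ by case/andP: zr.
+ move=> g gK; move: (hK g gK) eab fab hf (lft_lt_rgt g).
  by rewrite /enters /icross /a' /b'; clear; lia.
+ exact: (subsetP sM).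
+ by move: zr hf eab (lft_lt_rgt f); rewrite /enters; clear; lia.
Qed.

(** With [j = t] and [m = 0], failure yields a nonempty [M]; a member of it together with the
    [t]-twist entering it is a twist of size [t + 1]. *)
Theorem twist_free_colorable t : exists n, forall (I : intervals) (F : {set I}),
  clique_le (@icross I) t F -> colorable (@icross I) n F.
Proof.
have [n hn] := colorable_or_twist_enters t t 0; exists n => I F ht.
apply: contraT => /(hn I F ht)[a [b [M [sM Mab nM twM]]]].
have [M0|[e eM]] := set_0Vmem M; first by rewrite M0 colorable0 in nM.
have /existsP[K /and4P[sK cK /eqP tK /forall_inP hK]] := twM e eM.
have ek : {in K, forall g, icross e g}.
  move=> g gK; have := hK g gK; have ne : e != g.
    apply: contraTneq gK => <-; apply/negP => /hK; rewrite /enters.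
    by have := Mab e eM; have := lft_lt_rgt e; lia.
  have [] := endpoints_neq ne; rewrite eq_sym in ne; have [] := endpoints_neq ne.
  have := Mab e eM; rewrite /enters /icross; have := lft_lt_rgt g; lia.
have /clique_leP/(_ (e |: K)) := ht.
rewrite cardsU1 tK subUset sub1set (subsetP sM _ eM) sK => /(_ isT).
rewrite clique_setU1 //; last exact: icross_sym.
case: (boolP (e \in K)) => [/ek|_ /(_ isT)]; first by rewrite icross_irr.
by rewrite add1n ltnn.
Qed.

(** * Thick patterns as ordered graphs *)

Import Order.TTheory.

(* Common form of is_thick_twist (R1 = nest, R2 = cross) and is_thick_rainbow. *)
Definition is_thick (d : Order.disp_t) (V : finOrderType d) (R1 R2 : rel (V * V))
    (t : nat) (F : {set V * V}) : Prop :=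
  exists D : 'I_t -> {set V * V},
    [/\ F = \bigcup_i D i,
        forall i, (#|D i| == t) && clique R1 (D i),
        forall i j, i != j -> [disjoint endpoints (D i) & endpoints (D j)]
      & forall i j, i != j -> forall e f, e \in D i -> f \in D j -> R2 e f].

Section Pullback.
Variables (d d' : Order.disp_t) (V : finOrderType d) (W : finOrderType d').
Variable phi : W -> V.
Hypothesis phi_mono : {mono phi : x y / (x < y)%O}.

Definition edge_map (e : W * W) : V * V := (phi e.1, phi e.2).

Lemma edge_map_inj : injective edge_map.
Proof.
have inj : injective phi.
  by move=> x y E; case: (ltgtP x y) => //; rewrite -phi_mono E ltxx.
by move=> [x y] [x' y'] [/inj-> /inj->].
Qed.

Lemma cross_edge_map e f : cross (edge_map e) (edge_map f) = cross e f.
Proof. by rewrite /cross !phi_mono. Qed.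

Lemma nest_edge_map e f : nest (edge_map e) (edge_map f) = nest e f.
Proof. by rewrite /nest !phi_mono. Qed.

Lemma is_thick_pullback (R1 R2 : rel (V * V)) (R1' R2' : rel (W * W)) t (F : {set V * V}) :
  (forall e f, R1 (edge_map e) (edge_map f) = R1' e f) ->
  (forall e f, R2 (edge_map e) (edge_map f) = R2' e f) ->
  {in F, forall e, exists e', e = edge_map e'} ->
  is_thick R1 R2 t F -> is_thick R1' R2' t (edge_map @^-1: F).
Proof.
move=> E1 E2 onto [D [EF h1 h2 h3]]; rewrite EF in onto *; exists (fun i => edge_map @^-1: D i).
have ontoD i : edge_map @: (edge_map @^-1: D i) = D i.
  apply/setP => e; apply/imsetP/idP => [[e' + ->]|eD]; first by rewrite inE.
  have [|e' Ee] := onto e; last by exists e'; rewrite // inE -Ee.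
  by apply/bigcupP; exists i.
split=> [|i|i j ij|i j ij e f].
- by apply/setP => e; rewrite inE; apply/bigcupP/bigcupP => -[i _ h];
    exists i => //; move: h; rewrite inE.
- have /andP[/eqP cD /cliqueP hD] := h1 i.
  rewrite -(card_imset _ edge_map_inj) ontoD cD eqxx /=.
  apply/cliqueP => e f; rewrite !inE => eD fD ne; rewrite -E1; apply: hD => //.
  by rewrite (inj_eq edge_map_inj).
- rewrite disjoints_subset; apply/subsetP => v; rewrite !inE.
  have up k : [exists e in edge_map @^-1: D k, (v == e.1) || (v == e.2)] ->
      phi v \in endpoints (D k).
    case/exists_inP => e; rewrite inE => eD ve; rewrite inE.
    by apply/exists_inP; exists (edge_map e) => //; case/orP: ve => /eqP->; rewrite eqxx ?orbT.
  move=> /up vi; apply/negP => /up vj; move: (h2 i j ij).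
  by rewrite disjoints_subset => /subsetP/(_ _ vi); rewrite inE vj.
- by rewrite !inE -E2; apply: h3.
Qed.

End Pullback.

Section SubVertex.
Variables (d : Order.disp_t) (V : finOrderType d).
Definition subvertex (S : {set V}) := {v : V | v \in S}.
HB.instance Definition _ S := SubFinite.on (subvertex S).
HB.instance Definition _ S := [SubChoice_isSubOrder of subvertex S by <: with d].

Lemma subvertex_mono S : {mono (fun x : subvertex S => val x) : x y / (x < y)%O}.
Proof. by []. Qed.
End SubVertex.

Section EdgeSubgraph.
Variables (G : ograph) (F : {set vertex G * vertex G}).
Hypothesis sF : F \subset edges G.

Definition subadj (u v : subvertex (endpoints F)) : bool :=
  ((val u, val v) \in F) || ((val v, val u) \in F).

Lemma subadj_sym : symmetric subadj.
Proof. by move=> u v; apply: orbC. Qed.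

Lemma subadj_irr : irreflexive subadj.
Proof.
move=> u; rewrite /subadj orbb; apply/negP => /(subsetP sF).
by rewrite inE /= ltxx.
Qed.

(** The vertices are the endpoints of [F] only, as [is_thick_pattern] excludes isolated vertices. *)
Definition edge_subgraph := OGraph subadj_sym subadj_irr.

Let phi (v : subvertex (endpoints F)) : vertex G := val v.

Lemma edges_subgraph : edges edge_subgraph = edge_map phi @^-1: F.
Proof.
apply/setP => -[u v]; rewrite !inE /= /subadj /edge_map /=.
have lt_edge x y : (x, y) \in F -> (x < y)%O.
  by move=> /(subsetP sF); rewrite inE => /andP[].
apply/andP/idP => [[uv /orP[//|vu]]|uv];
  last by split; rewrite ?uv // -subvertex_mono; apply: lt_edge.
by have := lt_trans uv (lt_edge _ _ vu : (v < u)%O); rewrite ltxx.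
Qed.

Lemma edge_map_onto : {in F, forall e, exists e', e = edge_map phi e'}.
Proof.
move=> e eF; have h1 : e.1 \in endpoints F.
  by rewrite inE; apply/exists_inP; exists e; rewrite ?eqxx.
have h2 : e.2 \in endpoints F.
  by rewrite inE; apply/exists_inP; exists e; rewrite ?eqxx ?orbT.
by exists (Sub e.1 h1, Sub e.2 h2); rewrite /edge_map /phi !SubK; case: e {eF h1 h2}.
Qed.

Lemma contains_edge_subgraph : contains G edge_subgraph.
Proof.
exists phi; split=> [x y|x y]; first by [].
case/orP => /(subsetP sF); rewrite inE => /andP[_] //.
by rewrite adj_sym.
Qed.

Lemma endpoints_edge_subgraph : endpoints (edges edge_subgraph) = setT.
Proof.
apply/setP => v; rewrite !inE edges_subgraph; have := valP v.
rewrite inE => /exists_inP[e eF ve]; have [e' Ee] := edge_map_onto eF.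
apply/exists_inP; exists e'; first by rewrite inE -Ee.
by move: ve; rewrite Ee /= !(inj_eq val_inj).
Qed.

Lemma thick_contains t : F != set0 ->
  is_thick_twist t t F \/ is_thick_rainbow t t F ->
  exists H : ograph, is_thick_pattern t H /\ contains G H.
Proof.
move=> F0 thF; exists edge_subgraph; split; last exact: contains_edge_subgraph.
have mono := @subvertex_mono _ _ (endpoints F).
split; last 1 first.
- rewrite edges_subgraph; case: thF => h; [left|right];
  by apply: is_thick_pullback edge_map_onto h => e f; rewrite ?nest_edge_map ?cross_edge_map.
- have [e eF] := set0Pn _ F0; apply/set0Pn; have [e' Ee] := edge_map_onto eF.
  by exists e'; rewrite edges_subgraph inE -Ee.
- exact: endpoints_edge_subgraph.
Qed.

End EdgeSubgraph.

(** * Pages of matchings *)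

Lemma greedy_colorable (T : finType) (R : rel T) k (F : {set T}) :
  symmetric R -> irreflexive R ->
  {in F, forall e, #|[set f in F | R e f]| <= k} -> colorable R k.+1 F.
Proof.
move=> symR irR; move E: #|F| => n; elim: n F E => [|n IH] F E hF.
  by rewrite (cards0_eq E) colorable0.
have [F0|[e eF]] := set_0Vmem F; first by rewrite F0 cards0 in E.
have cE : #|F :\ e| = n by have := cardsD1 e F; rewrite eF; lia.
have /colorableP[c [c1 c2]] : colorable R k.+1 (F :\ e).
  apply: (IH _ cE) => f; rewrite inE => /andP[_ fF]; apply: leq_trans (hF f fF).
  by apply: subset_leq_card; apply/subsetP => g; rewrite !inE => /andP[/andP[_ ->]].
pose h f : 'I_k.+1 := inord (c f); pose N := [set f in F | R e f].
have [i ni] : exists i, i \notin h @: N.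
  apply/existsP; apply: contraT; rewrite negb_exists => /forallP all_in.
  have : #|'I_k.+1| <= k.
    apply: leq_trans (leq_trans (leq_imset_card h N) (hF e eF)).
    by apply: subset_leq_card; apply/subsetP => i _; move: (all_in i); rewrite negbK.
  by rewrite card_ord ltnn.
apply/colorableP; exists (fun f => if f == e then nat_of_ord i else c f).
have avoid f : f \in F -> f != e -> R e f -> c f <> i.
  move=> fF ne Ref cf; case/negP: ni; apply/imsetP; exists f.
    by rewrite inE fF.
  by apply: val_inj; rewrite /= inordK cf.
split=> [f fF|f g fF gF Rfg].
  by case: eqP => [_|/eqP ne]; [exact: ltn_ord | apply: c1; rewrite !inE ne].
case: eqP => [fe|/eqP nf]; case: eqP => [ge|/eqP ng].
- by move: Rfg; rewrite fe ge irR.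
- by rewrite fe in Rfg => /esym; apply: avoid.
- by rewrite ge symR in Rfg; apply: avoid.
- by apply: c2; rewrite // !inE ?nf ?ng.
Qed.

Section Pages.
Variables (d : Order.disp_t) (V : finOrderType d).
Implicit Types (e f : V * V) (M : {set V * V}).

Definition touch e f :=
  (e != f) && [|| e.1 == f.1, e.1 == f.2, e.2 == f.1 | e.2 == f.2].

Lemma touch_sym : symmetric touch.
Proof.
move=> e f; rewrite /touch (eq_sym f e) !(eq_sym f.1) !(eq_sym f.2).
by congr (_ && (_ || _)); rewrite orbCA.
Qed.

Definition matching M := {in M &, forall e f, ~~ touch e f}.

(* c numbers the pages, separately for the stacks (s e) and the queues.        *)
Definition paged n M := exists (s : V * V -> bool) (c : V * V -> nat),
  {in M, forall e, c e < n} /\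
  {in M &, forall e f, s e = s f -> c e = c f ->
     ~~ (if s e then cross e f else nest e f)}.

Definition position (v : V) := #|[set u : V | (u < v)%O]|.

Lemma position_lt : {mono position : u v / (u < v)%O >-> u < v}.
Proof.
have hom u v : (u < v)%O -> position u < position v.
  move=> uv; apply: proper_card; rewrite properE; apply/andP; split.
    by apply/subsetP => w; rewrite !inE => /lt_trans; apply.
  by apply/subsetPn; exists u; rewrite !inE ?ltxx.
by move=> u v; case: (ltgtP u v) => [/hom->//|/hom h|->]; rewrite ?ltnn //; lia.
Qed.

Lemma position_inj : injective position.
Proof. by move=> u v E; case: (ltgtP u v) => //; rewrite -position_lt E ltnn. Qed.

Section MatchingIntervals.
Variable M : {set V * V}.
Hypotheses (ltM : {in M, forall e, (e.1 < e.2)%O}) (matM : matching M).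

Definition medge := {e : V * V | e \in M}.

Lemma matching_lt (e : medge) : position (val e).1 < position (val e).2.
Proof. by rewrite position_lt ltM ?(valP e). Qed.

Lemma matching_neq (e f : medge) : e != f ->
  [/\ position (val e).1 <> position (val f).1,
      position (val e).2 <> position (val f).2
    & position (val e).1 <> position (val f).2].
Proof.
move=> ne; have := matM (valP e) (valP f); rewrite /touch (inj_eq val_inj) ne /=.
by rewrite !negb_or => /and4P[/eqP h1 /eqP h2 _ /eqP h3]; split=> /position_inj.
Qed.

Definition matching_intervals : intervals := Intervals matching_lt matching_neq.

Lemma icross_matching (e f : matching_intervals) : icross e f = cross (val e) (val f).
Proof. by rewrite /icross /cross /= !position_lt. Qed.

Lemma inest_matching (e f : matching_intervals) : inest e f = nest (val e) (val f).
Proof. by rewrite /inest /nest /= !position_lt. Qed.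

Lemma thick_matching (R1 R2 : rel matching_intervals) (Q1 Q2 : rel (V * V)) t :
  (forall e f : matching_intervals, R1 e f = Q1 (val e) (val f)) ->
  (forall e f : matching_intervals, R2 e f = Q2 (val e) (val f)) ->
  (forall e f, Q2 e f -> [&& e.1 != f.1, e.1 != f.2, e.2 != f.1 & e.2 != f.2]) ->
  thick R1 R2 t.+1 t.+1 setT ->
  exists F : {set V * V}, [/\ F \subset M, F != set0 & is_thick Q1 Q2 t.+1 F].
Proof.
move=> E1 E2 disj [D [_ h2 h3]].
have trim (i : 'I_t.+1) :
    exists B : {set matching_intervals}, B \subset D i /\ #|B| = t.+1.
  by have [/exists_subset_card[B] ] := h2 i (ltn_ord i); exists B.
have [D' hD'] := fin_all_exists trim.
pose R i := [set val e | e in D' i].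
exists (\bigcup_i R i); split.
- by apply/bigcupsP => i _; apply/subsetP => _ /imsetP[e _ ->]; apply: valP.
- have /card_gt0P[e eD] : 0 < #|D' ord0| by rewrite (hD' ord0).2.
  by apply/set0Pn; exists (val e); apply/bigcupP; exists ord0 => //; apply: imset_f.
have joined i j : i != j -> forall e f, e \in R i -> f \in R j -> Q2 e f.
  move=> ij _ _ /imsetP[e eD ->] /imsetP[f fD ->]; rewrite -E2.
  by apply: (h3 i j); rewrite ?ltn_ord //; apply: subsetP (hD' _).1 _ _.
exists R; split=> // [i|i j ij].
  rewrite card_imset ?(hD' i).2 ?eqxx //=; last exact: val_inj.
  apply/cliqueP => _ _ /imsetP[e eD ->] /imsetP[f fD ->]; rewrite (inj_eq val_inj) -E1.
  have [_ /cliqueP] := h2 i (ltn_ord i).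
  by apply; apply: subsetP (hD' _).1 _ _.
rewrite disjoints_subset; apply/subsetP => v; rewrite !inE => /exists_inP[e eR ve].
apply/negP => /exists_inP[f fR vf]; have /and4P := disj _ _ (joined i j ij e f eR fR).
by case/orP: ve => /eqP<-; case/orP: vf => /eqP<-; rewrite eqxx; case.
Qed.

End MatchingIntervals.

Lemma cross_disjoint e f :
  cross e f -> [&& e.1 != f.1, e.1 != f.2, e.2 != f.1 & e.2 != f.2].
Proof.
rewrite /cross -!position_lt -!(inj_eq position_inj); lia.
Qed.

Lemma nest_disjoint e f :
  nest e f -> [&& e.1 != f.1, e.1 != f.2, e.2 != f.1 & e.2 != f.2].
Proof.
rewrite /nest -!position_lt -!(inj_eq position_inj); lia.
Qed.

End Pages.

(** Without thick patterns, [intervals_split] leaves only the splitting: one part takes [n2] stacks,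
    the other [n1] queues. *)
Lemma matching_paged t : exists n : nat, forall (G : ograph)
    (M : {set vertex G * vertex G}),
  M \subset edges G -> matching M ->
  ~ (exists H : ograph, is_thick_pattern t.+1 H /\ contains G H) -> paged n M.
Proof.
have [n1 h1] := intervals_split t.+1 t.+1; have [n2 h2] := twist_free_colorable n1.
exists (maxn n2 n1) => G M sM matM noH.
have ltM : {in M, forall e, (e.1 < e.2)%O}.
  by move=> e /(subsetP sM); rewrite inE => /andP[].
pose I := matching_intervals ltM matM.
have [spl|thX|thN] := h1 I setT.
- have [A [B [_ _ EAB hA hB]]] := splitE spl.
  have /colorableP[cA [cA1 cA2]] := h2 I A hA.
  have /colorableP[cB [cB1 cB2]] := inest_colorable hB.
  pose s e := if (insub e : option (medge M)) is Some x then (x : I) \in A else false.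
  pose c e := if (insub e : option (medge M)) is Some x then
    (if (x : I) \in A then cA x else cB x) else 0.
  have insM e (eM : e \in M) : insub e = Some (Sub e eM : medge M) :=
    insubT (fun e => e \in M) eM.
  exists s, c; split=> [e eM|e f eM fM].
    rewrite /c (insM _ eM) /=; case: ifP => [/cA1|nA]; rewrite leq_max.
      by move->.
    have /setP/(_ (Sub e eM)) := EAB; rewrite in_setU nA inE /= => /cB1 ->.
    by rewrite orbT.
  rewrite /s /c !(insM _ eM) !(insM _ fM).
  have inB (x : I) : x \in A = false -> x \in B.
    by move=> nA; have /setP/(_ x) := EAB; rewrite in_setU nA inE.
  case: ifP => [eA /esym fA|/negbT eA /esym/negbT fA].
    rewrite fA => /eqP; apply: contraL => ef; apply/eqP; apply: cA2 => //.
    by rewrite icross_matching.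
  rewrite (negbTE fA) => /eqP; apply: contraL => ef; apply/eqP; apply: cB2.
  + by apply/inB/negbTE.
  + by apply/inB/negbTE.
  + by rewrite inest_matching.
- have [F [sF F0 thF]] := thick_matching (@inest_matching _ _ M ltM matM)
    (@icross_matching _ _ M ltM matM) (@cross_disjoint _ _) thX.
  by case: noH; apply: thick_contains (subset_trans sF sM) _ F0 _; left.
- have [F [sF F0 thF]] := thick_matching (@icross_matching _ _ M ltM matM)
    (@inest_matching _ _ M ltM matM) (@nest_disjoint _ _) thN.
  by case: noH; apply: thick_contains (subset_trans sF sM) _ F0 _; right.
Qed.

(** * Layouts *)

Lemma mixed_page_number_le (G : ograph) s q :
  has_layout G s q -> mixed_page_number G <= s + q.
Proof.
move=> h; rewrite /mixed_page_number; case: ex_minnP => m _; apply.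
by apply/has_mixed_layoutP; exists s, q.
Qed.

Lemma mixed_page_numberP (G : ograph) :
  exists s q, s + q = mixed_page_number G /\ has_layout G s q.
Proof.
by rewrite /mixed_page_number; case: ex_minnP => m /has_mixed_layoutP.
Qed.

Lemma paged_layout (G : ograph) n : paged n (edges G) -> has_layout G n n.
Proof.
case=> [s [c [cn pg]]].
pose P (x : 'I_n + 'I_n) : {set vertex G * vertex G} :=
  match x with
  | inl i => [set e in edges G | s e && (c e == i)]
  | inr i => [set e in edges G | ~~ s e && (c e == i)]
  end.
apply/existsP; exists [ffun x => P x]; apply/and4P; split.
- apply/eqP/setP => e; apply/bigcupP/idP => [[x _]|eG].
    by rewrite ffunE; case: x => i; rewrite inE => /andP[].
  case se: (s e); [exists (inl (Ordinal (cn e eG))) | exists (inr (Ordinal (cn e eG)))];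
    by rewrite // ffunE in_set eG se /= eqxx.
- apply/forallP => x; apply/forallP => y; apply/implyP => xy.
  rewrite !ffunE disjoints_subset; apply/subsetP => e.
  case: x xy => i; case: y => j ij; rewrite !inE => /and3P[/andP[-> ->] se /eqP ce] /=;
    rewrite ?se ?(negbTE se) ?ce //=; apply: contra ij => /eqP/val_inj->; exact: eqxx.
- apply/forallP => i; rewrite ffunE.
  apply/forall_inP => e; rewrite inE => /and3P[eG se /eqP ce].
  apply/forall_inP => f; rewrite inE => /and3P[fG sf /eqP cf].
  by have := pg e f eG fG; rewrite se sf ce cf; apply.
- apply/forallP => i; rewrite ffunE.
  apply/forall_inP => e; rewrite inE => /and3P[eG se /eqP ce].
  apply/forall_inP => f; rewrite inE => /and3P[fG sf /eqP cf].
  by have := pg e f eG fG; rewrite (negbTE se) (negbTE sf) ce cf; apply.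
Qed.

(** Each of the two ends of [e] has at most [D] neighbors, counted as pairs in both orientations. *)
Lemma touch_degree (G : ograph) D : max_degree G <= D ->
  {in edges G, forall e, #|[set f in edges G | touch e f]| <= 4 * D}.
Proof.
move=> hD e _; pose N u := [set w : vertex G | adj u w].
have cN u : #|N u| <= D by apply: leq_trans (leq_bigmax u) hD.
pose S u := [set (u, w) | w in N u] :|: [set (w, u) | w in N u].
have cS u : #|S u| <= 2 * D.
  apply: leq_trans (leq_card_setU _ _) _; rewrite mul2n -addnn.
  by apply: leq_add; apply: leq_trans (leq_imset_card _ _) (cN u).
have -> : 4 * D = 2 * D + 2 * D by lia.
apply: leq_trans (leq_add (cS e.1) (cS e.2)).
apply: leq_trans (leq_card_setU _ _); apply: subset_leq_card.
have S1 f u : f \in edges G -> u == f.1 -> f \in S u.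
  rewrite inE => /andP[_ af] /eqP->; rewrite inE; apply/orP; left.
  by apply/imsetP; exists f.2; [rewrite inE | case: (f)].
have S2 f u : f \in edges G -> u == f.2 -> f \in S u.
  rewrite inE => /andP[_ af] /eqP->; rewrite inE; apply/orP; right.
  by apply/imsetP; exists f.1; [rewrite inE adj_sym | case: (f)].
apply/subsetP => f; rewrite inE => /andP[fG /andP[_ /or4P[]]] h; rewrite inE.
- by rewrite (S1 f _ fG h).
- by rewrite (S2 f _ fG h).
- by rewrite (S1 f _ fG h) orbT.
- by rewrite (S2 f _ fG h) orbT.
Qed.

Lemma bounded_degree_paged (G : ograph) D n : max_degree G <= D ->
  (forall M : {set vertex G * vertex G}, M \subset edges G -> matching M -> paged n M) ->
  paged ((4 * D).+1 * n) (edges G).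
Proof.
move=> hD hM.
have irr_touch : irreflexive (@touch _ (vertex G)) by move=> e; rewrite /touch eqxx.
have /colorableP[k [k1 k2]] :=
  greedy_colorable (@touch_sym _ (vertex G)) irr_touch (touch_degree hD).
pose M (i : 'I_(4 * D).+1) := [set e in edges G | k e == i].
have /fin_all_exists[s /fin_all_exists[c sc]] : forall i, paged n (M i).
  move=> i; apply: hM; first by apply/subsetP => e; rewrite inE => /andP[].
  move=> e f; rewrite !inE => /andP[eG /eqP ke] /andP[fG /eqP kf].
  by apply/negP => /(k2 e f); rewrite !inE ke kf => /(_ eG fG).
pose K e : 'I_(4 * D).+1 := inord (k e).
have KM e : e \in edges G -> e \in M (K e).
  by move=> eG; rewrite inE eG /= inordK // k1.
(* The matching and the page within it are the two digits in base [n], so equal page numbers force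
   the same matching. *)
exists (fun e => s (K e) e), (fun e => K e * n + c (K e) e); split=> [e eG|e f eG fG].
  have [/(_ e (KM e eG)) ce _] := sc (K e).
  have : (K e).+1 * n <= (4 * D).+1 * n by rewrite leq_mul2r ltn_ord orbT.
  by rewrite mulSn; lia.
move=> ss cc; have [/(_ e (KM e eG)) ce _] := sc (K e).
have [/(_ f (KM f fG)) cf _] := sc (K f).
have n0 : 0 < n by lia.
have EK : K e = K f.
  apply: val_inj; have := congr1 (divn^~ n) cc.
  by rewrite /= !divnMDl // !divn_small // !addn0.
have [_ h] := sc (K e); rewrite -EK in ss cc; apply: h; rewrite ?KM ?EK ?KM -?EK //.
by move: cc; lia.
Qed.

(** Pages in [A] forbid [R2]-pairs and pages in [B] forbid [R1]-pairs. If every block has an edge on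
    an [A]-page, these pages differ from block to block; otherwise some block uses [B]-pages only,
    one per edge. *)
Lemma thick_page_bound (d : Order.disp_t) (V : finOrderType d) (A B : finType)
    (g : V * V -> A + B) (R1 R2 : rel (V * V)) t (F : {set V * V}) :
  {in F &, forall e f, e != f -> g e = g f ->
     ~~ (if g e is inl _ then R2 e f else R1 e f)} ->
  is_thick R1 R2 t F -> t <= #|A| + #|B|.
Proof.
move=> hg [D [EF h1 h2 h3]].
have DF i e : e \in D i -> e \in F by move=> eD; rewrite EF; apply/bigcupP; exists i.
have joined_neq i j e f : i != j -> e \in D i -> f \in D j -> e != f.
  move=> ij eD fD; apply/eqP => ef; move: (h2 i j ij); rewrite -ef in fD.
  rewrite disjoints_subset => /subsetP/(_ e.1); rewrite !inE => h.
  suff /negP[] : ~~ [exists e0 in D j, (e.1 == e0.1) || (e.1 == e0.2)].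
    by apply/exists_inP; exists e; rewrite ?eqxx.
  by apply: h; apply/exists_inP; exists e; rewrite ?eqxx.
case: (boolP [forall i, [exists e in D i, if g e is inl _ then true else false]]).
  move=> /forallP hl; suff : t <= #|A| by lia.
  have pick i : exists a, exists2 e, e \in D i & g e = inl a.
    have /exists_inP[e eD] := hl i; case E: (g e) => [a|//] _.
    by exists a, e.
  have [h hh] := fin_all_exists pick.
  rewrite -[t]card_ord; apply: (leq_card h) => i j hij.
  have [e eD ge] := hh i; have [f fD gf] := hh j.
  apply/eqP; apply: contraT => ij.
  have := hg e f (DF _ _ eD) (DF _ _ fD) (joined_neq _ _ _ _ ij eD fD).
  by rewrite ge gf hij (h3 i j ij e f eD fD) => /(_ erefl).
rewrite negb_forall => /existsP[i]; rewrite negb_exists => /forallP hr.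
suff : t <= #|B| by lia.
have /andP[/eqP <- /cliqueP hD] := h1 i.
have isr e : e \in D i -> exists b, g e = inr b.
  by move=> eD; move: (hr e); rewrite eD; case: (g e) => [//|b] _; exists b.
have [D0|[e0 /isr[b0 _]]] := set_0Vmem (D i); first by rewrite D0 cards0.
pose h e := if g e is inr b then b else b0.
have inj : {in D i &, injective h}.
  move=> e f eD fD; have [b gb] := isr e eD; have [b' gb'] := isr f fD.
  rewrite /h gb gb' => bb; apply/eqP; apply: contraT => ne.
  have := hg e f (DF _ _ eD) (DF _ _ fD) ne.
  by rewrite gb gb' bb (hD e f eD fD ne) => /(_ erefl).
by rewrite -(card_in_imset inj) max_card.
Qed.

Lemma thick_pattern_le (G H : ograph) t :
  is_thick_pattern t H -> contains G H -> t <= mixed_page_number G.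
Proof.
move=> [H0 _ thH] [phi [phi_lt phi_adj]].
have mono : {mono phi : x y / (x < y)%O}.
  move=> x y; case: (ltgtP x y) => [/phi_lt->//|/phi_lt h|->]; last exact: ltxx.
  by apply/negbTE; rewrite -leNgt ltW.
have [s [q [<- /existsP[P /and4P[/eqP EP _ /forallP hs /forallP hq]]]]] :=
  mixed_page_numberP G.
have page e : e \in edges H -> exists x, edge_map phi e \in P x.
  rewrite inE => /andP[lt ad]; have : edge_map phi e \in edges G.
    by rewrite inE /= mono lt phi_adj.
  by rewrite -EP => /bigcupP[x _ h]; exists x.
have [e0 /page[x0 _]] := set0Pn _ H0.
pose g e := odflt x0 [pick x | edge_map phi e \in P x].
have gP e : e \in edges H -> edge_map phi e \in P (g e).
  move=> /page[x hx]; rewrite /g; case: pickP => [y //|/(_ x)].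
  by rewrite hx.
have stack e f i : e \in edges H -> f \in edges H -> g e = inl i -> g f = inl i ->
    ~~ cross e f.
  move=> /gP + /gP + ge gf; rewrite ge gf -(cross_edge_map mono) => he hf.
  by have /forall_inP/(_ _ he)/forall_inP := hs i; apply.
have queue e f i : e \in edges H -> f \in edges H -> g e = inr i -> g f = inr i ->
    ~~ nest e f.
  move=> /gP + /gP + ge gf; rewrite ge gf -(nest_edge_map mono) => he hf.
  by have /forall_inP/(_ _ he)/forall_inP := hq i; apply.
rewrite -[s]card_ord -[q]card_ord; case: thH => th.
  apply: (thick_page_bound (g := g) (R1 := @nest _ _) (R2 := @cross _ _)) th.
  move=> e f eH fH _ gef; case E: (g e) => [i|i];
  by [apply: (stack _ _ i); rewrite -?gef | apply: (queue _ _ i); rewrite -?gef].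
(* For a thick rainbow, stacks and queues exchange roles. *)
rewrite addnC.
apply: (thick_page_bound (g := fun e => match g e with inl a => inr a | inr b => inl b end)
   (R1 := @cross _ _) (R2 := @nest _ _)) th.
move=> e f eH fH _ gef; case E: (g e) => [i|i]; rewrite E in gef.
  by apply: (stack _ _ i) => //; case: (g f) gef => // j [->].
by apply: (queue _ _ i) => //; case: (g f) gef => // j [->].
Qed.

Theorem theorem3 (GG : ograph -> Prop) (hdeg : bounded_max_degree GG) :
  bounded_mixed_page_number GG <->
  exists k : nat, forall G : ograph, GG G ->
    forall t : nat, k < t ->
      ~ exists H : ograph, is_thick_pattern t H /\ contains G H.
Proof.
split=> [[c hc]|[k hk]].
  exists c => G GGG t ct [H [thH cH]].
  by have := thick_pattern_le thH cH; have := hc G GGG; lia.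
have [D hD] := hdeg; have [n hn] := matching_paged k.
(* Each of the [4 * D + 1] matchings receives [n] stacks and [n] queues. *)
exists ((4 * D).+1 * n + (4 * D).+1 * n) => G GGG.
apply/mixed_page_number_le/paged_layout/bounded_degree_paged; first exact: hD.
by move=> M sM matM; apply: hn sM matM (hk G GGG k.+1 (ltnSn k)).
Qed.
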